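(* Let $g\ge1$ and let $P^{(g)}_\bullet$ be the perfect chain complex. If $k\le g-2$ then $H_k\big(P^{(g)}_\bullet\big)=0$.
   Context: Perfect cones. Identify quadratic forms on $\mathbb{R}^g$ with symmetric real $g\times g$ matrices. $\Omega_g$ is the cone of positive definite forms and $\Omega_g^{\mathrm{rt}}$ the set of positive semidefinite forms whose kernel is defined over $\mathbb{Q}$. $h\in\mathrm{GL}_g(\mathbb{Z})$ acts by $Q\mapsto hQh^t$. For $Q\in\Omega_g$ let $M(Q)$ be the set of nonzero vectors of $\mathbb{Z}^g$ at which $Q$ attains its minimum on $\mathbb{Z}^g\setminus\{0\}$, and $\sigma[Q]=\mathbb{R}_{\ge0}\langle \xi\xi^t:\xi\in M(Q)\rangle$. $\Sigma_g^{\mathrm P}$ is the set of all cones $\sigma[Q]$, $Q\in\Omega_g$, together with $\{0\}$; its elements are called perfect cones. It is a $\mathrm{GL}_g(\mathbb{Z})$-invariant collection of rational polyhedral cones, closed under taking faces, any two meeting along a common face, with finitely many orbits and union $\Omega_g^{\mathrm{rt}}$. The dimension of a cone is that of its linear span. Orientations. An orientation of a cone is an orientation of its linear span. If $\rho$ is a facet of $\sigma$ and $\omega_\sigma$ an orientation of $\sigma$, the induced orientation $\omega_\sigma|_\rho$ is represented by an ordered basis $(v_1,\dots,v_n)$ of $\mathbb{R}\rho$ such that $(v_1,\dots,v_n,v)$ is positive for $\omega_\sigma$, where $v$ is a generator of any ray of $\sigma$ not in $\rho$. A cone $\sigma\in\Sigma_g^{\mathrm P}$ is alternating if every element of $\mathrm{GL}_g(\mathbb{Z})$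 stabilizing $\sigma$ acts on it preserving orientation. Perfect chain complex. For each $n$ let $\Gamma_n$ be a set of representatives of the $\mathrm{GL}_g(\mathbb{Z})$-orbits of alternating cones of dimension $n+1$ in $\Sigma_g^{\mathrm P}$. Choose orientations $\omega_\sigma$ for $\sigma\in\Gamma_n$, and extend them to all alternating cones by the $\mathrm{GL}_g(\mathbb{Z})$-action. For $\sigma\in\Gamma_n$, $\sigma'\in\Gamma_{n-1}$ set $\delta(\sigma',\sigma)=\sum_\rho\eta(\rho,\sigma)$, the sum over facets $\rho$ of $\sigma$ in the $\mathrm{GL}_g(\mathbb{Z})$-orbit of $\sigma'$, with $\eta(\rho,\sigma)=1$ if $\omega_\rho=\omega_\sigma|_\rho$ and $-1$ otherwise. $P^{(g)}_n$ is the $\mathbb{Q}$-vector space with basis $\{e_\sigma:\sigma\in\Gamma_n\}$, and $\partial e_\sigma=\sum_{\sigma'\in\Gamma_{n-1}}\delta(\sigma',\sigma)e_{\sigma'}$. *)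

(* Defs.v *)
From HB Require Import structures.
From mathcomp Require Import all_boot all_order all_algebra.
From mathcomp Require Import all_classical reals.
From mathcomp Require Import generic_quotient ring_quotient freeg.

Set Implicit Arguments.
Unset Strict Implicit.
Unset Printing Implicit Defensive.

Import Order.TTheory GRing.Theory Num.Theory.
Local Open Scope classical_set_scope.
Local Open Scope ring_scope.

Section Cones.
Context {R : realType} {V : vectType R}.
Implicit Types (C F : set V) (U : {vspace V}) (b c : seq V) (o : set (seq V)).

Definition conic_hull (S : set V) : set V :=
  [set x | exists s : seq (R * V),
     (forall p, p \in s -> 0 <= p.1 /\ S p.2) /\ x = \sum_(p <- s) p.1 *: p.2].

Definition is_linear_span C U : Prop :=
  (forall x, C x -> x \in U) /\
  (forall W : {vspace V}, (forall x, C x -> x \in W) -> (U <= W)%VS).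

Definition linear_span C : {vspace V} := xget 0%VS (is_linear_span C).

Lemma linear_spanP C : is_linear_span C (linear_span C).
Proof.
suff [U HU] : exists U, is_linear_span C U by exact: (xgetPex 0%VS (ex_intro _ U HU)).
pose good n := `[< exists2 W : {vspace V}, forall x, C x -> x \in W & \dim W = n >].
have ex : exists n, good n.
  by exists (\dim {:V}); apply/asboolP; exists fullv => // x _; rewrite memvf.
case: (ex_minnP ex) => n /asboolP[U CU dU] nmin.
exists U; split=> // W CW.
have CUW x : C x -> x \in (U :&: W)%VS by move=> Cx; rewrite memv_cap CU ?CW.
have le : (\dim U <= \dim (U :&: W))%N.
  by rewrite dU; apply: nmin; apply/asboolP; exists (U :&: W)%VS.
have /eqP <- : (U :&: W == U)%VS by rewrite eqEdim capvSl.
exact: capvSr.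
Qed.

Definition cone_dim C : nat := \dim (linear_span C).

Definition face C F : Prop :=
  exists l : {scalar V},
    (forall x, C x -> 0 <= l x) /\ F = [set x | C x /\ l x = 0].

Definition facet C F : Prop := face C F /\ cone_dim C = (cone_dim F).+1.

Definition ray_generator C (v : V) : Prop :=
  v != 0 /\ face C [set x | exists2 a : R, 0 <= a & x = a *: v].

Definition basis_change_det b c : R :=
  \det (\matrix_(i < size b, j < size b) coord (in_tuple b) j c`_i).

(* An orientation is encoded by its set of positive ordered bases. In dimension
   zero the empty basis may be declared positive or not, so there are two
   orientations there as well, [set [::]] and set0. *)
Definition orientation U o : Prop :=
  (forall b, o b -> basis_of U b) /\
  (forall b c, basis_of U b -> basis_of U c ->
     (o b <-> o c) <-> 0 < basis_change_det b c).

Definition induced_orientation C F o : set (seq V) :=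
  [set b | basis_of (linear_span F) b /\
     exists v, [/\ ray_generator C v, ~ F v & o (rcons b v)]].

End Cones.

(* homology f h is ker h / (im f :&: ker h), which is ker h / im f as soon as
   h \o f = 0. *)
Section Homology.
Context {A B C : zmodType} (f : {additive A -> B}) (h : {additive B -> C}).

Definition cycle_pred : {pred B} := [pred x | h x == 0].

Fact cycle_closed : zmod_closed cycle_pred.
Proof.
by split=> [|x y /eqP hx /eqP hy]; rewrite inE ?raddf0 // raddfB hx hy subrr.
Qed.
HB.instance Definition _ := GRing.isZmodClosed.Build B cycle_pred cycle_closed.

Record cycles := Cycle { cycle_val :> B; _ : cycle_val \in cycle_pred }.
HB.instance Definition _ := [isSub for cycle_val].
HB.instance Definition _ := [Choice of cycles by <:].
HB.instance Definition _ := [SubChoice_isSubZmodule of cycles by <:].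

Definition boundaries : {pred cycles} := [pred z | `[< exists x, f x = val z >]].

Fact boundaries_closed : zmod_closed boundaries.
Proof.
split=> [|z w /asboolP[x zx] /asboolP[y wy]]; apply/asboolP.
  by exists 0; rewrite !raddf0.
by exists (x - y); rewrite !raddfB zx wy.
Qed.
HB.instance Definition _ :=
  GRing.isZmodClosed.Build cycles boundaries boundaries_closed.

Definition homology : zmodType := Quotient.quot boundaries.

End Homology.

Section PerfectCones.
Context {R : realType} {g : nat}.
Local Notation form := 'M[R]_g.
Implicit Types (Q : form) (h : 'M[int]_g) (s t r : set form) (o : set (seq form)).

Definition form_eval Q (x : 'cV[R]_g) : R := (x^T *m Q *m x) 0 0.

Definition positive_definite Q : Prop :=
  Q^T = Q /\ forall x, x != 0 -> 0 < form_eval Q x.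

Definition lattice_vec (xi : 'cV[int]_g) : 'cV[R]_g := map_mx intr xi.

Definition minimal_vectors Q : set 'cV[int]_g :=
  [set xi | xi != 0 /\ forall zeta, zeta != 0 ->
     form_eval Q (lattice_vec xi) <= form_eval Q (lattice_vec zeta)].

Definition sigma Q : set form :=
  conic_hull [set lattice_vec xi *m (lattice_vec xi)^T | xi in minimal_vectors Q].

Definition perfect_cone s : Prop :=
  s = [set 0] \/ exists2 Q, positive_definite Q & s = sigma Q.

Definition act h Q : form := map_mx intr h *m Q *m (map_mx intr h)^T.

Definition act_cone h s : set form := act h @` s.

Definition act_orientation h o : set (seq form) := map (act h) @` o.

Definition same_orbit s t : Prop := exists2 h, h \in unitmx & t = act_cone h s.

Definition alternating s : Prop :=
  perfect_cone s /\
  forall h, h \in unitmx -> act_cone h s = s ->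
    forall o, orientation (linear_span s) o -> act_orientation h o = o.

Definition alternating_cones (n : int) : set (set form) :=
  [set s | alternating s /\ (cone_dim s)%:Z = n + 1].

End PerfectCones.

Record perfect_complex_data (R : realType) (g : nat) := PerfectComplexData {
  reps : int -> set (set 'M[R]_g);
  reps_sub : forall n s, reps n s -> alternating_cones n s;
  reps_exist : forall n s, alternating_cones n s ->
    exists2 t, reps n t & same_orbit t s;
  reps_uniq : forall n s t, reps n s -> reps n t -> same_orbit s t -> s = t;
  rep_orientation : set 'M[R]_g -> set (seq 'M[R]_g);
  rep_orientationP : forall n s, reps n s ->
    orientation (linear_span s) (rep_orientation s)
}.

Section PerfectComplex.
Context {R : realType} {g : nat} (D : perfect_complex_data R g).
Implicit Types s t r : set 'M[R]_g.

(* Transport of the chosen orientations along GL_g(Z). For alternating r the set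
   below is a singleton, so xget makes no choice. *)
Definition cone_orientation r : set (seq 'M[R]_g) :=
  xget set0 [set o | exists n s h, [/\ reps D n s, h \in unitmx,
    r = act_cone h s & o = act_orientation h (rep_orientation D s)]].

Definition eta r s : rat :=
  if `[< cone_orientation r = induced_orientation s r (cone_orientation s) >]
  then 1 else -1.

Definition delta t s : rat :=
  \sum_(r \in [set r | facet s r /\ same_orbit t r]) eta r s.

Definition perfect_chain (n : int) := {freeg (reps D n) / rat}.
HB.instance Definition _ n := GRing.Lmodule.on (perfect_chain n).

Definition chain_basis n (s : reps D n) : perfect_chain n := [freeg [:: (1, s)]].

(* The differential of degree n is boundary n (n - 1). Leaving the target degree
   free avoids transporting along n + 1 - 1 = n when composing. *)
Definition boundary (m n : int) : perfect_chain m -> perfect_chain n :=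
  fglift (fun s : reps D m =>
    \sum_(t \in [set: reps D n]) delta (val t) (val s) *: chain_basis t).

Fact boundary_is_additive m n : additive (@boundary m n).
Proof. exact: lift_is_additive. Qed.
HB.instance Definition _ m n :=
  GRing.isAdditive.Build (perfect_chain m) (perfect_chain n)
    (@boundary m n) (@boundary_is_additive m n).

Definition perfect_homology (k : int) : zmodType :=
  homology (@boundary (k + 1) k) (@boundary k (k - 1)).

End PerfectComplex.

(* Main.v *)
Require Import Defs.
From HB Require Import structures.
From mathcomp Require Import all_boot all_order all_algebra perm.
From mathcomp Require Import finmap all_classical reals.
From mathcomp Require Import generic_quotient ring_quotient freeg ring lra zify.

(** Write s + x for the cone spanned by s and the rank one form x = xi xi^t,
    where xi is a coloop: some integral functional takes the value 1 at xi and
    vanishes on the vectors spanning s. A perfect cone s with dim s < g has a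
    perfect inflation s + x, unique up to GL_g(Z), because its vectors lie in a
    proper direct summand of Z^g. A cone with two coloops is not alternating, since
    exchanging them reverses the orientation; if s has no coloop, then s is
    alternating if and only if s + x is. Hence in degrees at most g - 2 inflation
    matches the alternating orbits without coloop with the alternating orbits having
    one. The facets of s + x are s and the F + x with F a facet of s, so s is its
    only facet without coloop. For a cycle z of degree k <= g - 2 put
    w = sum_s z_s delta(s, s + x) e_(s + x) over the s without coloop. Then dw and z
    have the same coefficients at the cones without coloop. At a cone F + x the
    equality follows from the F-coefficient of dz = 0 and the identity
      delta(F, s) delta(s, s + x) = - delta(F, F + x) delta(F + x, s + x). *)

(** The bound on k enters only through ranks. A cone of degree k has dimension k + 1 < g, and the
    lattice spanned by its vectors has rank at most that dimension, so its saturation is a proper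
    summand and leaves room for a new primitive vector. The obstacle is integrality: real linear
    algebra gives neither a coloop functional nor an extension of an equivalence of cones to an
    element of GL_g(Z). Both come from the Smith normal form, through an integral projector onto the
    saturation. An integral matrix that annihilates the forms of s annihilates the image of this
    projector, so integral identities checked on s extend to the whole saturation. The base s can be
    recovered from s + x because s has no coloop; with several coloops the base would not be
    determined. Orientations are handled throughout as signs of determinants on a single basis. *)

Set Implicit Arguments.
Unset Strict Implicit.
Unset Printing Implicit Defensive.

Import Order.TTheory GRing.Theory Num.Theory.
Local Open Scope classical_set_scope.
Local Open Scope ring_scope.

(** * Bases and orientations *)

Section BasisChange.
Context {R : realType} {V : vectType R}.
Implicit Types (U : {vspace V}) (b c e : seq V) (o : set (seq V)).

Lemma basis_size U b : basis_of U b -> size b = \dim U.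
Proof. by move=> Ub; rewrite (@size_basis _ _ U (size b) (in_tuple b)). Qed.

(** The size [n] is only propositionally equal to [size b], so block and permutation matrices can be
    supplied later without casts. *)
Lemma basis_change_detE n (A : 'M[R]_n) b c : size b = n -> free b ->
  (forall i : 'I_n, c`_i = \sum_(j < n) A i j *: b`_j) ->
  basis_change_det b c = \det A.
Proof.
move=> szb; case: _ / szb A => A fb cE; rewrite /basis_change_det.
by congr (\det _); apply/matrixP => i j; rewrite mxE cE coord_sum_free.
Qed.

Lemma basis_change_exists n b c : size b = n -> size c = n ->
    (forall x, x \in c -> x \in <<b>>%VS) ->
  exists A : 'M[R]_n, forall i : 'I_n, c`_i = \sum_(j < n) A i j *: b`_j.
Proof.
move=> szb; case: _ / szb => szc cb.
exists (\matrix_(i, j) coord (in_tuple b) j c`_i) => i.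
have ci : c`_i \in <<b>>%VS by apply: cb; rewrite mem_nth ?szc.
rewrite {1}(coord_span (X := in_tuple b) ci).
by apply: eq_bigr => j _; rewrite mxE.
Qed.

Lemma basis_change_detM U b c e : basis_of U b -> basis_of U c -> basis_of U e ->
  basis_change_det b e = basis_change_det b c * basis_change_det c e.
Proof.
move=> Ub Uc Ue.
have sp x y : basis_of U x -> basis_of U y -> forall z, z \in x -> z \in <<y>>%VS.
  by move=> Ux Uy z zx; rewrite (span_basis Uy); exact: basis_mem Ux zx.
have [A cE] := basis_change_exists (basis_size Ub) (basis_size Uc) (sp _ _ Uc Ub).
have [B eE] := basis_change_exists (basis_size Uc) (basis_size Ue) (sp _ _ Ue Uc).
rewrite (basis_change_detE (basis_size Ub) (basis_free Ub) cE).
rewrite (basis_change_detE (basis_size Uc) (basis_free Uc) eE).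
rewrite mulrC -det_mulmx; apply: basis_change_detE (basis_size Ub) (basis_free Ub) _.
move=> i; rewrite eE.
under eq_bigr => j _ do rewrite cE scaler_sumr.
rewrite exchange_big /=; apply: eq_bigr => k _.
by rewrite mxE scaler_suml; apply: eq_bigr => j _; rewrite scalerA.
Qed.

Lemma basis_change_det_refl b : free b -> basis_change_det b b = 1.
Proof.
move=> fb; rewrite -(det1 _ (size b)); apply: basis_change_detE => // i.
rewrite (bigD1 i) //= mxE eqxx scale1r big1 ?addr0 // => j ji.
by rewrite mxE eq_sym (negPf ji) scale0r.
Qed.

Lemma basis_change_det_sym U b c : basis_of U b -> basis_of U c ->
  basis_change_det b c * basis_change_det c b = 1.
Proof.
move=> Ub Uc; rewrite -(basis_change_detM Ub Uc Ub).
exact: basis_change_det_refl (basis_free Ub).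
Qed.

Lemma basis_change_det_neq0 U b c : basis_of U b -> basis_of U c ->
  basis_change_det b c != 0.
Proof.
move=> Ub Uc; apply/eqP => d0; have := basis_change_det_sym Ub Uc.
by rewrite d0 mul0r => /eqP; rewrite eq_sym oner_eq0.
Qed.

Lemma basis_change_det_map (f : {linear V -> V}) U b c :
    basis_of U b -> basis_of U c -> free (map f b) ->
  basis_change_det (map f b) (map f c) = basis_change_det b c.
Proof.
move=> Ub Uc ffb.
have sp : forall z, z \in c -> z \in <<b>>%VS.
  by move=> z zc; rewrite (span_basis Ub); exact: basis_mem Uc zc.
have [A cE] := basis_change_exists (basis_size Ub) (basis_size Uc) sp.
rewrite (basis_change_detE (basis_size Ub) (basis_free Ub) cE).
apply: basis_change_detE; rewrite ?size_map ?(basis_size Ub) //.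
move=> i; rewrite (nth_map 0) ?(basis_size Uc) // cE linear_sum.
by apply: eq_bigr => j _; rewrite linearZ (nth_map 0) ?(basis_size Ub).
Qed.

(** Modulo the span of [b], the vector [w] is [a] times [v], so the matrix of the change of basis is
    block triangular with last diagonal entry [a]. *)
Lemma basis_change_det_rcons b c v w a : free (rcons b v) -> size c = size b ->
    (forall x, x \in c -> x \in <<b>>%VS) -> w - a *: v \in <<b>>%VS ->
  basis_change_det (rcons b v) (rcons c w) = basis_change_det b c * a.
Proof.
move=> fbv szc cb wb.
have fb : free b by apply: (@catl_free _ _ [:: v]); rewrite cats1.
have [A cE] := basis_change_exists erefl szc cb.
rewrite (basis_change_detE erefl fb cE).
pose u : 'rV[R]_(size b) := \row_j coord (in_tuple b) j (w - a *: v).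
have -> : \det A * a = \det (block_mx A 0 u a%:M).
  by rewrite det_lblock det_scalar1.
apply: basis_change_detE => //; first by rewrite size_rcons addn1.
move=> i; rewrite big_split_ord /= big_ord1.
have blast : (rcons b v)`_(size b) = v by rewrite nth_rcons ltnn eqxx.
have bj (j : 'I_(size b)) : (rcons b v)`_j = b`_j by rewrite nth_rcons ltn_ord.
rewrite [X in (rcons b v)`_X]addn0 blast.
under eq_bigr => j _ do rewrite bj.
case: (split_ordP i) => k ->.
  rewrite /= nth_rcons szc ltn_ord cE block_mxEur mxE scale0r addr0.
  by apply: eq_bigr => j _; rewrite block_mxEul.
rewrite ord1 /= addn0 nth_rcons szc ltnn eqxx block_mxEdr mxE eqxx mulr1n.
apply/eqP; rewrite -subr_eq; apply/eqP.
rewrite {1}(coord_span (X := in_tuple b) wb).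
by apply: eq_bigr => j _; rewrite block_mxEdl mxE.
Qed.

(** This transposition is the source of both signs in the argument: the anticommutation of facets
    and the reversal of orientation by exchanging two coloops. *)
Lemma basis_change_det_swap b x v : free (rcons (rcons b x) v) ->
  basis_change_det (rcons (rcons b x) v) (rcons (rcons b v) x) = -1.
Proof.
move=> fb; pose n := (size b).+2.
pose i0 : 'I_n := inord (size b); pose i1 : 'I_n := inord (size b).+1.
have i01 : i0 != i1 by rewrite -val_eqE /= !inordK // neq_ltn ltnSn.
have -> : -1 = \det (tperm_mx i0 i1 : 'M[R]_n).
  by rewrite det_perm odd_tperm i01 expr1.
apply: basis_change_detE; rewrite ?size_rcons //.
move=> i; rewrite (bigD1 (tperm i0 i1 i)) //= [X in _ + X]big1 => [|j ji]; last first.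
  by rewrite !mxE eq_sym (negPf ji) scale0r.
rewrite !mxE eqxx scale1r addr0.
have n0 : nat_of_ord i0 = size b by rewrite inordK.
have n1 : nat_of_ord i1 = (size b).+1 by rewrite inordK.
case: tpermP => [->|->|/eqP ne0 /eqP ne1].
- by rewrite n0 n1 !nth_rcons !size_rcons ltnSn !ltnn !eqxx.
- by rewrite n0 n1 !nth_rcons !size_rcons ltnSn !ltnn !eqxx.
- have lti : (i < size b)%N.
    have ne0' : nat_of_ord i <> size b by rewrite -n0 => /val_inj/eqP; apply/negP.
    have ne1' : nat_of_ord i <> (size b).+1 by rewrite -n1 => /val_inj/eqP; apply/negP.
    by have := ltn_ord i; rewrite {2}/n; lia.
  by rewrite !nth_rcons !size_rcons (ltn_trans lti (ltnSn _)) lti.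
Qed.

Lemma orientation_transfer U o b c : orientation U o ->
  basis_of U b -> basis_of U c -> 0 < basis_change_det b c -> o b <-> o c.
Proof. by move=> [_ Uo] Ub Uc; move/(Uo _ _ Ub Uc). Qed.

Lemma orientation_opposite U o b c : orientation U o ->
  basis_of U b -> basis_of U c -> basis_change_det b c < 0 -> o b <-> ~ o c.
Proof.
move=> [_ Uo] Ub Uc d; have := Uo _ _ Ub Uc; rewrite ltNge ltW //= => H.
split=> [ob oc|noc]; first by have /H : o b <-> o c.
by apply: contrapT => nob; have /H : o b <-> o c.
Qed.

(** Two orientations of one space are equal or opposite, so a single basis decides. *)
Lemma orientation_eqP U o o' b : orientation U o -> orientation U o' ->
  basis_of U b -> o = o' <-> (o b <-> o' b).
Proof.
move=> Uo Uo' Ub; split=> [->//|oo'].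
apply/seteqP; split=> c oc.
- have Uc := Uo.1 _ oc; have := Uo.2 _ _ Ub Uc; have := Uo'.2 _ _ Ub Uc.
  by case: (EM (o b)); case: (EM (o c)); case: (EM (o' c)); tauto.
- have Uc := Uo'.1 _ oc; have := Uo.2 _ _ Ub Uc; have := Uo'.2 _ _ Ub Uc.
  by case: (EM (o b)); case: (EM (o c)); case: (EM (o' c)); tauto.
Qed.

(** The condition in [alternating] quantifies over all orientations; one must exist before it says
    anything about determinants. *)
Lemma orientation_exists U : exists o, orientation U o.
Proof.
have Uv := vbasisP U.
exists [set c | basis_of U c /\ 0 < basis_change_det (vbasis U) c]; split=> [c []//|].
move=> b c Ub Uc /=; rewrite (basis_change_detM Uv Ub Uc).
have := basis_change_det_neq0 Uv Ub; have := basis_change_det_neq0 Ub Uc.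
case/lt_total/orP => hbc; case/lt_total/orP => hb.
- rewrite nmulr_rgt0 // (lt_gtF hb) (lt_gtF hbc) hbc.
  by split=> // -[_ /(_ (conj Uc isT)) []].
- rewrite pmulr_rgt0 // (lt_gtF hbc) hb.
  by split=> // -[/(_ (conj Ub isT)) []].
- rewrite nmulr_rgt0 // (lt_gtF hb) (lt_gtF hbc) hbc.
  by split=> // _; split=> -[].
- by rewrite pmulr_rgt0 // hbc hb.
Qed.

End BasisChange.

(** * Cones and facets *)

Lemma finite_subsets (T : choiceType) (A : set T) :
  finite_set A -> finite_set [set B | B `<=` A].
Proof.
move=> finA; apply: (@sub_finite_set _ _
  ((fun X : {fset T} => [set` X]) @` [set` fpowerset (fset_set A)])).
  move=> B BA; exists (fset_set B); last by rewrite fset_setK //; exact: sub_finite_set finA.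
  rewrite /= fpowersetE; apply/fsubsetP => x.
  rewrite !in_fset_set //; last exact: sub_finite_set finA.
  by rewrite !inE; exact: BA.
by apply: finite_image; exact: finite_fset.
Qed.

Section ConeGeometry.
Context {R : realType} {V : vectType R}.
Implicit Types (C F H S : set V) (U : {vspace V}) (b c : seq V).
Implicit Types (o : set (seq V)) (l m : {scalar V}).

Lemma mem_linear_span C x : C x -> x \in linear_span C.
Proof. exact: (linear_spanP C).1. Qed.

Lemma linear_span_sub C U : (forall x, C x -> x \in U) -> (linear_span C <= U)%VS.
Proof. exact: (linear_spanP C).2. Qed.

Lemma linear_span_eq C U : (forall x, C x -> x \in U) ->
  (forall W : {vspace V}, (forall x, C x -> x \in W) -> (U <= W)%VS) ->
  linear_span C = U.
Proof.
move=> CU UW; apply/eqP; rewrite eqEsubv linear_span_sub //=.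
by apply: UW => x; exact: mem_linear_span.
Qed.

Lemma scalar_eq0_span C l x : (forall y, C y -> l y = 0) ->
  x \in linear_span C -> l x = 0.
Proof.
move=> Cl; pose f : 'Hom(V, R^o) := linfun (l : {linear V -> R^o}).
have: (linear_span C <= lker f)%VS.
  by apply: linear_span_sub => y Cy; rewrite memv_ker lfunE /= Cl.
by move/subvP => sub /sub; rewrite memv_ker lfunE /= => /eqP.
Qed.

Lemma scalar_exists (f : V -> R) : (forall a u v, f (a *: u + v) = a * f u + f v) ->
  exists l : {scalar V}, forall x, l x = f x.
Proof.
move=> fL; pose fM := GRing.isLinear.Build R V R *%R f fL.
by exists (HB.pack_for {scalar V} f fM).
Qed.

Lemma face_sub C F : face C F -> F `<=` C.
Proof. by move=> [l [_ ->]] x []. Qed.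

Lemma ray_generator_mem C v : ray_generator C v -> C v.
Proof.
by case=> _ /face_sub; apply => /=; exists 1; rewrite ?ler01 ?scale1r.
Qed.

(** The supporting functional vanishes on the span of [F] but not at [v], and the dimension
    condition leaves room for only one further vector. *)
Lemma facet_span C F v : facet C F -> C v -> ~ F v ->
  linear_span C = (linear_span F + <[v]>)%VS /\ v \notin linear_span F.
Proof.
move=> [[l [l0 FE]] dCF] Cv nFv.
have nv : v \notin linear_span F.
  apply/negP => vF; apply: nFv; rewrite FE; split=> //.
  by apply: scalar_eq0_span vF => y; rewrite FE => -[].
split=> //; apply/esym/eqP; rewrite eqEdim subv_add; apply/andP; split.
  apply/andP; split; last by rewrite -memvE mem_linear_span.
  by apply: linear_span_sub => y; rewrite FE => -[Cy _]; exact: mem_linear_span.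
move: dCF; rewrite /cone_dim => ->.
rewrite dimv_disjoint_sum ?dim_vline; last first.
  apply/eqP; rewrite -subv0; apply/subvP => y; rewrite memv_cap memv0.
  case/andP => yF /vlineP[k yk]; apply: contraNT nv => y0.
  have k0 : k != 0 by apply: contraNneq y0 => k0; rewrite yk k0 scale0r.
  by rewrite -[v](scalerK k0) -yk memvZ.
by rewrite (_ : v != 0) ?addn1 //; apply: contraNneq nv => ->; exact: mem0v.
Qed.

Lemma basis_rcons U b v : basis_of U b -> v \notin U ->
  basis_of (U + <[v]>) (rcons b v).
Proof.
move=> Ub vU; rewrite /basis_of -cats1 span_cat (span_basis Ub) span_seq1 eqxx /=.
rewrite (perm_free (permEl (perm_catC _ _))) /= free_cons.
by rewrite (span_basis Ub) vU (basis_free Ub).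
Qed.

Lemma facet_basis C F v b : facet C F -> C v -> ~ F v ->
  basis_of (linear_span F) b -> basis_of (linear_span C) (rcons b v).
Proof. by move=> CF Cv nFv Fb; have [-> nv] := facet_span CF Cv nFv; exact: basis_rcons. Qed.

(** The supporting functional is positive at [v] and [w], and [a] is the ratio of its values. Its
    positivity makes the induced orientation independent of the chosen ray. *)
Lemma facet_same_side C F v w : facet C F -> C v -> ~ F v -> C w -> ~ F w ->
  exists2 a : R, 0 < a & w - a *: v \in linear_span F.
Proof.
move=> CF Cv nFv Cw nFw.
have [CE _] := facet_span CF Cv nFv.
have := mem_linear_span Cw; rewrite CE => /memv_addP[f fF [_ /vlineP[a ->] wE]].
exists a; last by rewrite wE addrK.
have [[l [l0 FE]] _] := CF.
have lf : l f = 0 by apply: scalar_eq0_span fF => y; rewrite FE => -[].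
have lpos u : C u -> ~ F u -> 0 < l u.
  move=> Cu nFu; rewrite lt_neqAle l0 // andbT eq_sym.
  by apply/eqP => lu; apply: nFu; rewrite FE.
have := lpos w Cw nFw; rewrite wE linearD lf add0r linearZ /=.
by rewrite pmulr_lgt0 // lpos.
Qed.

Lemma facet_orientationP C F o v w b c : facet C F ->
    orientation (linear_span C) o -> C v -> ~ F v -> C w -> ~ F w ->
    basis_of (linear_span F) b -> basis_of (linear_span F) c ->
  (o (rcons b v) <-> o (rcons c w)) <-> 0 < basis_change_det b c.
Proof.
move=> CF Co Cv nFv Cw nFw Fb Fc.
have Cb := facet_basis CF Cv nFv Fb; have Cc := facet_basis CF Cw nFw Fc.
rewrite (Co.2 _ _ Cb Cc).
have [a a0 wa] := facet_same_side CF Cv nFv Cw nFw.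
rewrite (basis_change_det_rcons (a := a) (basis_free Cb)) ?pmulr_lgt0 //.
- by rewrite (basis_size Fb) (basis_size Fc).
- by move=> x xc; rewrite (span_basis Fb); exact: basis_mem Fc xc.
- by rewrite (span_basis Fb).
Qed.

Lemma induced_orientationP C F o v b : facet C F ->
    orientation (linear_span C) o -> ray_generator C v -> ~ F v ->
    basis_of (linear_span F) b ->
  induced_orientation C F o b <-> o (rcons b v).
Proof.
move=> CF Co Cv nFv Fb; split=> [[_ [w [Cw nFw ow]]]|ob]; last first.
  by split=> //; exists v.
have [Cv' Cw'] := (ray_generator_mem Cv, ray_generator_mem Cw).
have [_ H] := facet_orientationP CF Co Cw' nFw Cv' nFv Fb Fb.
by have /H[+ _] : 0 < basis_change_det b b; [rewrite (basis_change_det_refl (basis_free Fb))|apply].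
Qed.

Lemma induced_orientation_is C F o v : facet C F ->
    orientation (linear_span C) o -> ray_generator C v -> ~ F v ->
  orientation (linear_span F) (induced_orientation C F o).
Proof.
move=> CF Co Cv nFv; split=> [b []//|b c Fb Fc].
rewrite !(induced_orientationP CF Co Cv nFv) //.
have Cv' := ray_generator_mem Cv.
exact: (facet_orientationP CF Co Cv' nFv Cv' nFv Fb Fc).
Qed.

Lemma eq_induced_orientationP C F o o' v b : facet C F ->
    orientation (linear_span C) o -> orientation (linear_span F) o' ->
    ray_generator C v -> ~ F v -> basis_of (linear_span F) b ->
  o' = induced_orientation C F o <-> (o' b <-> o (rcons b v)).
Proof.
move=> CF Co Fo' Cv nFv Fb.
rewrite (orientation_eqP Fo' (induced_orientation_is CF Co Cv nFv) Fb).
by rewrite (induced_orientationP CF Co Cv nFv).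
Qed.

(** * Adding a ray to a cone, and the facets of the result *)

Definition cone_add C x : set V :=
  [set z | exists y (c : R), [/\ C y, 0 <= c & z = y + c *: x]].

Section ConeAdd.
Variables (C : set V) (x : V) (m : {scalar V}).
Hypotheses (C0 : C 0) (mC : forall y, C y -> m y = 0) (mx : m x = 1).

Lemma cone_add_sub : C `<=` cone_add C x.
Proof. by move=> y Cy; exists y, 0; rewrite scale0r addr0. Qed.

Lemma mem_cone_add : cone_add C x x.
Proof. by exists 0, 1; rewrite scale1r add0r ler01. Qed.

(** The functional [m] reads off the coefficient of [x], so a point of the sum decomposes
    uniquely. *)
Lemma cone_add_scalar z : cone_add C x z -> 0 <= m z /\ C (z - m z *: x).
Proof.
move=> [y [c [Cy c0 ->]]].
by rewrite linearD linearZ /= mC // mx mulr1 add0r addrK.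
Qed.

Lemma cone_add_section : C = [set z | cone_add C x z /\ m z = 0].
Proof.
apply/seteqP; split=> z /= => [Cz|[/cone_add_scalar[_ +] mz]].
  by split; [exact: cone_add_sub|exact: mC].
by rewrite mz scale0r subr0.
Qed.

Lemma notin_span_cone_add : x \notin linear_span C.
Proof.
apply/negP => /(scalar_eq0_span (l := m) mC) /eqP.
by rewrite mx oner_eq0.
Qed.

Lemma linear_span_cone_add :
  linear_span (cone_add C x) = (linear_span C + <[x]>)%VS.
Proof.
apply: linear_span_eq => [z [y [c [Cy _ ->]]]|W CW].
  by rewrite memv_add ?mem_linear_span // memvZ // memv_line.
rewrite subv_add -memvE CW ?andbT; last exact: mem_cone_add.
by apply: linear_span_sub => y Cy; apply: CW; exact: cone_add_sub.
Qed.

Lemma basis_cone_add b : basis_of (linear_span C) b ->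
  basis_of (linear_span (cone_add C x)) (rcons b x).
Proof.
by rewrite linear_span_cone_add => Cb; exact: basis_rcons notin_span_cone_add.
Qed.

Lemma cone_dim_add : cone_dim (cone_add C x) = (cone_dim C).+1.
Proof.
have Cb := vbasisP (linear_span C).
rewrite /cone_dim -(basis_size (basis_cone_add Cb)) size_rcons.
by rewrite (basis_size Cb).
Qed.

Lemma facet_cone_add_base : facet (cone_add C x) C.
Proof.
split; last exact: cone_dim_add.
by exists m; split; [move=> z /cone_add_scalar[]|exact: cone_add_section].
Qed.

End ConeAdd.

Section ConeAddFacets.
Variables (C : set V) (x : V) (m : {scalar V}).
Hypotheses (C0 : C 0) (mC : forall y, C y -> m y = 0) (mx : m x = 1).

Lemma face0 F : face C F -> F 0.
Proof. by move=> [l [_ ->]]; split=> //; rewrite linear0. Qed.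

Lemma facet_cone_add_facet F : facet C F -> facet (cone_add C x) (cone_add F x).
Proof.
move=> [Ff dF]; have F0 := face0 Ff; have [l [l0 FE]] := Ff.
have mF y : F y -> m y = 0 by move/(face_sub Ff); exact: mC.
split; last by rewrite (cone_dim_add C0 mC mx) dF (cone_dim_add F0 mF mx).
(* Subtracting a multiple of [m] makes the functional vanish at [x] and leaves its values on [C]
   unchanged. *)
have [l' l'E] : exists l' : {scalar V}, forall z, l' z = l z - l x * m z.
  by apply: scalar_exists => a u v; rewrite !linearD !linearZ /=; ring.
have l'C y (c : R) : C y -> l' (y + c *: x) = l y.
  by move=> Cy; rewrite l'E !linearD !linearZ /= mx mC //; ring.
exists l'; split=> [z [y [c [Cy c0 ->]]]|]; first by rewrite l'C // l0.
apply/seteqP; split=> z.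
  move=> [y [c [Fy c0 ->]]]; split.
    by exists y, c; split=> //; exact: face_sub Ff _ Fy.
  by move: Fy; rewrite FE => -[Cy ly]; rewrite l'C.
move=> [[y [c [Cy c0 ->]]]]; rewrite l'C // => ly.
by exists y, c; split=> //; rewrite FE.
Qed.

(** A supporting functional either vanishes at [x], and then the face contains the added ray and
    comes from a face of [C], or is positive there. In the second case the face lies in [C] and has
    the same dimension, hence is [C]. *)
Lemma facet_cone_addP H : facet (cone_add C x) H ->
  H = C \/ exists2 F, facet C F & H = cone_add F x.
Proof.
move=> [[l [l0 HE]] dH].
have lC y : C y -> 0 <= l y by move=> Cy; apply: l0; exact: cone_add_sub.
have lx : 0 <= l x by apply: l0; exact: mem_cone_add.
pose F := [set y | C y /\ l y = 0].
have Ff : face C F by exists l.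
have F0 := face0 Ff.
have mF y : F y -> m y = 0 by move/(face_sub Ff); exact: mC.
move: dH; rewrite (cone_dim_add C0 mC mx) => -[dH].
have lE y (c : R) : C y -> 0 <= c -> l (y + c *: x) = 0 <-> l y = 0 /\ c * l x = 0.
  move=> Cy c0; rewrite linearD linearZ /= /GRing.scale /=.
  split=> [/eqP|[-> ->]]; last by rewrite addr0.
  by rewrite paddr_eq0 ?lC ?mulr_ge0 // => /andP[/eqP-> /eqP->].
have [lx0|lx0] := eqVneq (l x) 0; [right|left].
  have HF : H = cone_add F x.
    rewrite HE; apply/seteqP; split=> z.
      move=> [[y [c [Cy c0 ->]]]] /lE[]// ly _.
      by exists y, c.
    move=> [y [c [[Cy ly] c0 ->]]]; split; first by exists y, c.
    by apply/lE; rewrite ?lx0 ?mulr0.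
  exists F => //; split=> //; rewrite dH HF; exact: cone_dim_add mF mx.
have HF : H = F.
  rewrite HE; apply/seteqP; split=> z.
    move=> [[y [c [Cy c0 ->]]]] /lE[]// ly /eqP.
    by rewrite mulf_eq0 (negPf lx0) orbF => /eqP ->; rewrite scale0r addr0.
  by move=> [Cz lz]; split=> //; exact: cone_add_sub.
rewrite HF; apply/seteqP; split=> [y []//|y Cy]; split=> //.
have FC : linear_span F = linear_span C.
  apply/eqP; rewrite eqEdim; apply/andP; split.
    by apply: linear_span_sub => z [Cz _]; exact: mem_linear_span.
  by move: dH; rewrite HF /cone_dim => ->.
have := mem_linear_span Cy; rewrite -FC.
by apply: scalar_eq0_span => z [].
Qed.

Lemma cone_add_inj F G : F `<=` C -> G `<=` C ->
  cone_add F x = cone_add G x -> F = G.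
Proof.
move=> FC GC FG.
rewrite (@cone_add_section F x m) ?FG //; last by move=> y /FC; exact: mC.
by rewrite -cone_add_section // => y /GC; exact: mC.
Qed.

(* Adding v and then x to a basis of F is opposite to adding x and then v. *)
Lemma facet_orientations_anticommute F v oF oC oG oS : facet C F ->
    ray_generator C v -> ~ F v -> ray_generator (cone_add C x) v ->
    ray_generator (cone_add F x) x -> ray_generator (cone_add C x) x ->
    orientation (linear_span F) oF -> orientation (linear_span C) oC ->
    orientation (linear_span (cone_add F x)) oG ->
    orientation (linear_span (cone_add C x)) oS ->
  (oF = induced_orientation C F oC <->
   oC = induced_orientation (cone_add C x) C oS) <->
  ~ (oF = induced_orientation (cone_add F x) F oG <->
     oG = induced_orientation (cone_add C x) (cone_add F x) oS).
Proof.
move=> CF Cv nFv Sv Gx Sx hF hC hG hS.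
have FC := face_sub CF.1; have F0 := face0 CF.1.
have mF y : F y -> m y = 0 by move/FC; exact: mC.
have nCx : ~ C x by move/mC/eqP; rewrite mx oner_eq0.
have nFx : ~ F x by move/FC.
have nGv : ~ cone_add F x v.
  move=> Gv; apply: nFv; rewrite (cone_add_section mF mx); split=> //.
  by apply: mC; exact: ray_generator_mem.
have Fb := vbasisP (linear_span F); set b := vbasis _ in Fb.
have Cb := facet_basis CF (ray_generator_mem Cv) nFv Fb.
have Gb := basis_cone_add F0 mF mx Fb.
have SC := facet_cone_add_base C0 mC mx.
have SG := facet_cone_add_facet CF.
have GF := facet_cone_add_base F0 mF mx.
rewrite (eq_induced_orientationP CF hC hF Cv nFv Fb).
rewrite (eq_induced_orientationP SC hS hC Sx nCx Cb).
rewrite (eq_induced_orientationP GF hG hF Gx nFx Fb).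
rewrite (eq_induced_orientationP SG hS hG Sv nGv Gb).
have Sb1 := basis_cone_add C0 mC mx Cb.
have Sb2 := facet_basis SG (ray_generator_mem Sv) nGv Gb.
have swap : oS (rcons (rcons b v) x) <-> ~ oS (rcons (rcons b x) v).
  apply: (orientation_opposite hS Sb1 Sb2).
  by rewrite basis_change_det_swap ?ltrN10 //; exact: basis_free Sb1.
case: (EM (oF b)); case: (EM (oC (rcons b v))); case: (EM (oG (rcons b x)));
  case: (EM (oS (rcons (rcons b v) x))); tauto.
Qed.

End ConeAddFacets.

(** * Conic hulls and their faces in terms of generators *)

Lemma conic_hull_sub S : S `<=` conic_hull S.
Proof.
move=> x Sx; exists [:: (1, x)]; split; last by rewrite big_seq1 scale1r.
by move=> p; rewrite inE => /eqP -> /=; rewrite ler01.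
Qed.

Lemma conic_hull0 S : conic_hull S 0.
Proof. by exists [::]; rewrite big_nil; split. Qed.

Lemma conic_hull_min S C : C 0 -> (forall x y, C x -> C y -> C (x + y)) ->
  (forall (a : R) x, 0 <= a -> S x -> C (a *: x)) -> conic_hull S `<=` C.
Proof.
move=> C0 CD CZ _ [s [sS ->]]; elim: s sS => [|p s IH] sS; first by rewrite big_nil.
rewrite big_cons; apply: CD.
  by have [] := sS p (mem_head _ _); exact: CZ.
by apply: IH => q qs; apply: sS; rewrite inE qs orbT.
Qed.

Lemma conic_hullD S x y : conic_hull S x -> conic_hull S y -> conic_hull S (x + y).
Proof.
move=> [s [sS ->]] [t [tS ->]]; exists (s ++ t); rewrite big_cat; split=> // p.
by rewrite mem_cat => /orP[/sS|/tS].
Qed.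

Lemma conic_hullZ S (a : R) x : 0 <= a -> conic_hull S x -> conic_hull S (a *: x).
Proof.
move=> a0 [s [sS ->]]; exists [seq (a * p.1, p.2) | p <- s]; split.
  by move=> _ /mapP[p /sS[p0 pS] ->]; rewrite mulr_ge0.
by rewrite big_map scaler_sumr; apply: eq_bigr => p _; rewrite scalerA.
Qed.

Lemma conic_hull_mono S T : S `<=` T -> conic_hull S `<=` conic_hull T.
Proof. by move=> ST _ [s [sS ->]]; exists s; split=> // p /sS[? /ST]. Qed.

Lemma conic_hull_setU1 S x : conic_hull (S `|` [set x]) = cone_add (conic_hull S) x.
Proof.
apply/seteqP; split.
  apply: conic_hull_min.
  - by exists 0, 0; rewrite scale0r addr0; split=> //; exact: conic_hull0.
  - move=> _ _ [y [c [Sy c0 ->]]] [z [d [Sz d0 ->]]]; exists (y + z), (c + d).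
    by rewrite addr_ge0 // scalerDl addrACA; split=> //; exact: conic_hullD.
  - move=> a y a0 [Sy|->].
      exists (a *: y), 0; rewrite scale0r addr0; split=> //.
      by apply: conic_hullZ => //; exact: conic_hull_sub.
    by exists 0, a; rewrite add0r; split=> //; exact: conic_hull0.
move=> _ [y [c [Sy c0 ->]]]; apply: conic_hullD.
  by apply: conic_hull_mono Sy; exact: subsetUl.
by apply: conic_hullZ => //; apply: conic_hull_sub; right.
Qed.

Lemma conic_hull_scalar_ge0 S l x : (forall y, S y -> 0 <= l y) ->
  conic_hull S x -> 0 <= l x.
Proof.
move=> lS; apply: (@conic_hull_min S [set x | 0 <= l x]) => /=.
- by rewrite linear0.
- by move=> y z ly lz; rewrite linearD addr_ge0.
- by move=> a y a0 /lS ly; rewrite linearZ mulr_ge0.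
Qed.

(** A sum of nonnegative terms vanishes only if every term does, so a point of the face uses only
    generators in the face. The induction carries the inequality along. *)
Lemma conic_hull_face S l : (forall y, S y -> 0 <= l y) ->
  [set x | conic_hull S x /\ l x = 0] = conic_hull [set x | S x /\ l x = 0].
Proof.
move=> lS; apply/seteqP; split.
  suff: conic_hull S `<=`
      [set x | 0 <= l x /\ (l x = 0 -> conic_hull [set x | S x /\ l x = 0] x)].
    by move=> sub x [/sub[_]].
  apply: conic_hull_min => /=.
  - by rewrite linear0; split=> // _; exact: conic_hull0.
  - move=> x y [lx Hx] [ly Hy]; rewrite linearD addr_ge0 //; split=> // /eqP.
    rewrite paddr_eq0 // => /andP[/eqP /Hx ? /eqP /Hy ?].
    exact: conic_hullD.
  - move=> a x a0 Sx; rewrite linearZ /= mulr_ge0 ?lS //; split=> // /eqP.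
    rewrite mulf_eq0 => /orP[/eqP ->|/eqP lx]; first by rewrite scale0r; exact: conic_hull0.
    by apply: conic_hullZ => //; apply: conic_hull_sub.
move=> x Sx; split; first by apply: conic_hull_mono Sx => y [].
apply/eqP; rewrite eq_le; apply/andP; split; last first.
  by apply: conic_hull_scalar_ge0 Sx => y [/lS].
rewrite -oppr_ge0 -[- l x]/((\- l) x).
by apply: conic_hull_scalar_ge0 Sx => y [_] /= ->; rewrite oppr0.
Qed.

(** Otherwise the span of [F] would contain all generators and the dimension would not drop. The
    vector obtained supplies the ray that orients the facet. *)
Lemma facet_conic_hull_notin S F : facet (conic_hull S) F -> exists2 v, S v & ~ F v.
Proof.
move=> [_ dF]; apply: contrapT => nv.
have SF : S `<=` F by move=> v Sv; apply: contrapT => nFv; apply: nv; exists v.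
have: (linear_span (conic_hull S) <= linear_span F)%VS.
  apply: linear_span_sub => x; apply: (@conic_hull_min S [set x | x \in linear_span F]).
  - exact: mem0v.
  - by move=> y z; exact: memvD.
  - by move=> a y _ /SF Fy; apply: memvZ; exact: mem_linear_span.
by move/dimvS; move: dF; rewrite /cone_dim => ->; rewrite ltnn.
Qed.

(** By [conic_hull_face], a facet is the hull of the generators that it contains. *)
Lemma finite_facets S : finite_set S -> finite_set [set F | facet (conic_hull S) F].
Proof.
move=> finS.
apply: (@sub_finite_set _ _ (conic_hull @` [set A | A `<=` S])); last first.
  by apply: finite_image; exact: finite_subsets.
move=> F [[l [l0 FE]] _]; exists [set x | S x /\ l x = 0]; first by move=> x [].
rewrite FE -conic_hull_face // => y Sy.
by apply: l0; exact: conic_hull_sub.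
Qed.

End ConeGeometry.

(** * Quadratic forms *)

Section Forms.
Context {R : realType} {g : nat}.
Local Notation form := 'M[R]_g.
Local Notation "A ^~" := (map_mx intr A : 'M[R]_(_, _)) (at level 2, format "A ^~").
Implicit Types (Q X : form) (h : 'M[int]_g) (s t : set form).
Implicit Types (x y z : 'cV[R]_g) (xi zeta lam : 'cV[int]_g) (M : set 'cV[int]_g).

Lemma intmx_inj m n : injective (fun A : 'M[int]_(m, n) => A^~).
Proof.
move=> A B AB; apply/matrixP => i j; apply: (@intr_inj R).
by move/matrixP: AB => /(_ i j); rewrite !mxE.
Qed.

Lemma intmx_eq0 m n (A : 'M[int]_(m, n)) : A^~ = 0 -> A = 0.
Proof. by move=> A0; apply: intmx_inj; rewrite A0 map_mx0. Qed.

Definition bilin Q x y : R := (x^T *m Q *m y) 0 0.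

Lemma form_eval_bilin Q x : form_eval Q x = bilin Q x x. Proof. by []. Qed.

Lemma bilinDl Q x y z : bilin Q (x + y) z = bilin Q x z + bilin Q y z.
Proof. by rewrite /bilin linearD /= !mulmxDl mxE. Qed.

Lemma bilinDr Q x y z : bilin Q x (y + z) = bilin Q x y + bilin Q x z.
Proof. by rewrite /bilin mulmxDr mxE. Qed.

Lemma bilinZl Q a x y : bilin Q (a *: x) y = a * bilin Q x y.
Proof. by rewrite /bilin linearZ -!scalemxAl mxE. Qed.

Lemma bilinZr Q a x y : bilin Q x (a *: y) = a * bilin Q x y.
Proof. by rewrite /bilin -scalemxAr mxE. Qed.

Lemma bilinC Q x y : Q^T = Q -> bilin Q x y = bilin Q y x.
Proof.
move=> QT; rewrite /bilin -[in RHS]QT -[in RHS](trmxK x) -!trmx_mul [in RHS]mxE.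
by rewrite !mulmxA.
Qed.

Lemma positive_definite1 : positive_definite (1%:M : form).
Proof.
split=> [|x x0]; first exact: trmx1.
rewrite /form_eval mulmx1 mxE.
under eq_bigr => i _ do rewrite mxE -expr2.
have [i xi] : exists i, x i 0 != 0.
  apply: contrapT => nx; move/eqP: x0; apply; apply/matrixP => i j.
  rewrite ord1 mxE; apply: contrapT => /eqP xi; apply: nx; by exists i.
rewrite (bigD1 i) //= ltr_pwDl ?exprn_even_gt0 //.
by apply: sumr_ge0 => j _; exact: sqr_ge0.
Qed.

Lemma form_eval0 Q : form_eval Q 0 = 0.
Proof. by rewrite /form_eval mulmx0 mxE. Qed.

Lemma form_eval_ge0 Q x : positive_definite Q -> 0 <= form_eval Q x.
Proof.
by move=> [_ Qp]; have [->|/Qp/ltW//] := eqVneq x 0; rewrite form_eval0.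
Qed.

(** A single identity yields both the inequality and its equality case; the latter identifies rays
    of rank one forms. *)
Lemma cauchy_schwarz_identity Q x z : Q^T = Q ->
  form_eval Q (form_eval Q x *: z - bilin Q x z *: x) =
  form_eval Q x * (form_eval Q x * form_eval Q z - bilin Q x z ^+ 2).
Proof.
move=> QT; rewrite !form_eval_bilin -scaleNr.
rewrite !(bilinDl, bilinDr, bilinZl, bilinZr) (bilinC z x QT); ring.
Qed.

Lemma cauchy_schwarz Q x z : positive_definite Q ->
  bilin Q x z ^+ 2 <= form_eval Q x * form_eval Q z.
Proof.
move=> pQ; have [->|x0] := eqVneq x 0.
  by rewrite form_eval0 /bilin trmx0 !mul0mx mxE expr0n mul0r.
rewrite -subr_ge0 -(pmulr_rge0 _ (pQ.2 _ x0)) -cauchy_schwarz_identity ?pQ.1 //.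
exact: form_eval_ge0.
Qed.

Lemma cauchy_schwarz_eq Q x z : positive_definite Q ->
  form_eval Q x * form_eval Q z = bilin Q x z ^+ 2 ->
  form_eval Q x *: z = bilin Q x z *: x.
Proof.
move=> pQ E; apply/eqP; rewrite -subr_eq0; apply/negPn/negP => /pQ.2.
by rewrite cauchy_schwarz_identity ?pQ.1 // E subrr mulr0 ltxx.
Qed.

Lemma positive_definite_unit Q : positive_definite Q -> Q \in unitmx.
Proof.
move=> pQ; rewrite -row_free_unit -kermx_eq0; apply/negPn/negP => /rowV0Pn[u].
move=> /sub_kermxP uQ u0.
have : u^T != 0 by apply: contra_neq u0 => u0; rewrite -[u]trmxK u0 trmx0.
by move/pQ.2; rewrite /form_eval trmxK uQ mul0mx mxE ltxx.
Qed.

(** The coordinate of index [i] is the [Q]-product with [v], the image of the unit vector under the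
    inverse of [Q], so Cauchy-Schwarz bounds it. *)
Lemma positive_definite_coord_bound Q i : positive_definite Q ->
  exists2 B : R, 0 <= B & forall x, x i 0 ^+ 2 <= B * form_eval Q x.
Proof.
move=> pQ; have Qu := positive_definite_unit pQ.
pose v : 'cV[R]_g := invmx Q *m delta_mx i 0; exists (form_eval Q v).
  exact: form_eval_ge0.
move=> x; suff -> : x i 0 = bilin Q v x by exact: cauchy_schwarz.
have vQ : v^T *m Q = delta_mx 0 i by rewrite -{1}pQ.1 -trmx_mul mulKVmx // trmx_delta.
by rewrite /bilin vQ -rowE mxE.
Qed.

Lemma finite_bounded_lattice (N : nat) :
  finite_set [set xi : 'cV[int]_g | forall i, (`|xi i 0%R| < N)%N].
Proof.
pose f (A : 'cV['I_(N + N)]_g) : 'cV[int]_g := \col_i ((A i 0)%:Z - N%:Z).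
apply: (@sub_finite_set _ _ (f @` setT)); last first.
  by apply: finite_image; exact: finite_finset.
move=> xi /= bxi.
have lt i : (`|(xi i 0 + N%:Z)%R| < N + N)%N by have := bxi i; lia.
exists (\col_i Ordinal (lt i)) => //; apply/matrixP => i j.
by rewrite ord1 !mxE /=; have := bxi i; lia.
Qed.

(** Finitely many generators give finitely many facets, hence the finite support needed to evaluate
    the sum in [boundary]. *)
Lemma finite_minimal_vectors Q : positive_definite Q -> finite_set (minimal_vectors Q).
Proof.
move=> pQ.
have [->|/set0P[xi0 Mxi0]] := eqVneq (minimal_vectors Q) set0.
  exact: finite_set0.
have [B B0 BP] : exists2 B : R, 0 <= B & forall i x, x i 0 ^+ 2 <= B * form_eval Q x.
  have /choice[B BP] : forall i, exists B : R, 0 <= B /\ forall x, x i 0 ^+ 2 <= B * form_eval Q x.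
    by move=> i; have [B ? ?] := positive_definite_coord_bound i pQ; exists B.
  exists (\sum_i B i); first by apply: sumr_ge0 => i _; have [] := BP i.
  move=> i x; apply: le_trans (_ : B i * form_eval Q x <= _); first by have [] := BP i.
  rewrite ler_wpM2r ?form_eval_ge0 // (bigD1 i) //= lerDl.
  by apply: sumr_ge0 => j _; have [] := BP j.
pose b := B * form_eval Q (lattice_vec xi0).
pose N := (Num.bound (1 + b)).+1.
apply: sub_finite_set (finite_bounded_lattice N) => xi Mxi i /=.
have xib : (xi i 0)%:~R ^+ 2 <= b.
  have := BP i (lattice_vec xi); rewrite mxE => /le_trans; apply.
  by rewrite ler_wpM2l //; apply: Mxi.2; exact: Mxi0.1.
have b0 : 0 <= b by rewrite mulr_ge0 ?form_eval_ge0.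
have lt1 : (`|xi i 0%R|%N)%:R < 1 + b :> R.
  rewrite natr_absz intr_norm; set a := (xi i 0)%:~R in xib *.
  have : `|a| ^+ 2 <= b by rewrite real_normK // num_real.
  have := normr_ge0 a; nra.
have := lt_trans lt1 (archi_boundP _); rewrite addr_ge0 ?ler01 // => /(_ isT).
by rewrite ltr_nat /N; lia.
Qed.

Definition rank1 xi : form := lattice_vec xi *m (lattice_vec xi)^T.

Definition rank1_hull M : set form := conic_hull (rank1 @` M).

Lemma rank1_tr xi : (rank1 xi)^T = rank1 xi.
Proof. by rewrite /rank1 trmx_mul trmxK. Qed.

Lemma lattice_vec_neq0 xi : xi != 0 -> (lattice_vec xi : 'cV[R]_g) != 0.
Proof. by apply: contra_neq => /intmx_eq0. Qed.

Lemma form_eval_rank1 xi x : form_eval (rank1 xi) x = bilin 1%:M (lattice_vec xi) x ^+ 2.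
Proof.
rewrite /form_eval /rank1 mulmxA -mulmxA [LHS]mxE big_ord1 expr2 /bilin mulmx1.
congr (_ * _); rewrite -[lattice_vec xi in LHS]trmxK -trmx_mul mxE.
by [].
Qed.

Lemma mxtrace_rank1 xi : \tr (rank1 xi) = form_eval 1%:M (lattice_vec xi).
Proof. by rewrite mxtrace_mulC /mxtrace big_ord1 /form_eval mulmx1. Qed.

Lemma rank1_hull_tr M X : rank1_hull M X -> X^T = X.
Proof.
apply: (@conic_hull_min _ _ _ [set X | X^T = X]) => /=.
- by rewrite trmx0.
- by move=> X1 X2 ? ?; rewrite linearD /= -/(_ + _); congr (_ + _).
- by move=> a _ _ [xi _ <-]; rewrite linearZ /= rank1_tr.
Qed.

Lemma form_eval_scalar x : exists l : {scalar form}, forall X, l X = form_eval X x.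
Proof.
apply: scalar_exists => a X Y.
by rewrite /form_eval mulmxDr mulmxDl mxE -scalemxAr -scalemxAl mxE.
Qed.

(* The form |xi|^2 I - xi xi^t is nonnegative on rank one forms and vanishes
   only on the ray of xi xi^t. *)
Lemma ray_generator_rank1 M xi : xi != 0 -> M xi ->
  ray_generator (rank1_hull M) (rank1 xi).
Proof.
move=> xi0 Mxi; have x0 := lattice_vec_neq0 xi0.
set x : 'cV[R]_g := lattice_vec xi in x0.
have xx : 0 < form_eval 1%:M x := positive_definite1.2 _ x0.
split.
  apply/eqP => E; have := mxtrace_rank1 xi; rewrite E linear0 => /esym/eqP.
  by rewrite gt_eqF.
have [l0 l0E] := form_eval_scalar x.
have [l lE] : exists l : {scalar form}, forall X,
    l X = form_eval 1%:M x * \tr X - form_eval X x.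
  apply: scalar_exists => a X Y.
  by rewrite -!l0E !linearD !linearZ /=; ring.
have lr zeta : l (rank1 zeta) = form_eval 1%:M x * form_eval 1%:M (lattice_vec zeta)
    - bilin 1%:M x (lattice_vec zeta) ^+ 2.
  by rewrite lE mxtrace_rank1 form_eval_rank1 bilinC // trmx1.
have lM X : (rank1 @` M) X -> 0 <= l X.
  by move=> [zeta _ <-]; rewrite lr subr_ge0 cauchy_schwarz //; exact: positive_definite1.
exists l; split=> [X|]; first exact: conic_hull_scalar_ge0.
rewrite [RHS](conic_hull_face lM); apply/seteqP; split.
  move=> _ [a a0 ->]; apply: conic_hullZ => //; apply: conic_hull_sub; split; first by exists xi.
  by rewrite lr -/x form_eval_bilin; ring.
apply: conic_hull_min => /=.
- by exists 0; rewrite ?scale0r.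
- by move=> _ _ [a a0 ->] [c c0 ->]; exists (a + c); rewrite ?addr_ge0 ?scalerDl.
- move=> a _ a0 [[zeta Mz <-]]; rewrite lr => /eqP; rewrite subr_eq0 => /eqP.
  move/(cauchy_schwarz_eq positive_definite1); set z := lattice_vec zeta => E.
  set c := bilin 1%:M x z / form_eval 1%:M x.
  have zE : z = c *: x.
    by rewrite /c mulrC -scalerA -E scalerK // gt_eqF.
  exists (a * c ^+ 2); first by rewrite mulr_ge0 ?sqr_ge0.
  by rewrite /rank1 -/z -/x zE linearZ -scalemxAl -scalemxAr !scalerA expr2 mulrA.
Qed.

(** Unlike perfection, this property passes to [cone_add s (rank1 xi)] at once, and it suffices for
    the integral linear algebra. *)
Definition lattice_cone s : Prop :=
  exists M, (forall xi, M xi -> xi != 0) /\ s = rank1_hull M.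

Lemma lattice_cone0 s : lattice_cone s -> s 0.
Proof. by move=> [M [_ ->]]; exact: conic_hull0. Qed.

Lemma lattice_coneD s X Y : lattice_cone s -> s X -> s Y -> s (X + Y).
Proof. by move=> [M [_ ->]]; exact: conic_hullD. Qed.

Lemma lattice_coneZ s (a : R) X : lattice_cone s -> 0 <= a -> s X -> s (a *: X).
Proof. by move=> [M [_ ->]]; exact: conic_hullZ. Qed.

Lemma lattice_cone_tr s X : lattice_cone s -> s X -> X^T = X.
Proof. by move=> [M [_ ->]]; exact: rank1_hull_tr. Qed.

Lemma rank1_hull_add M xi : rank1_hull (M `|` [set xi]) = cone_add (rank1_hull M) (rank1 xi).
Proof. by rewrite /rank1_hull image_setU image_set1 conic_hull_setU1. Qed.

Lemma lattice_cone_add s xi : xi != 0 -> lattice_cone s ->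
  lattice_cone (cone_add s (rank1 xi)).
Proof.
move=> xi0 [M [M0 ->]]; exists (M `|` [set xi]); split; last by rewrite rank1_hull_add.
by move=> zeta [/M0|->].
Qed.

Lemma perfect_cone_hull s : perfect_cone s ->
  exists M, [/\ finite_set M, forall xi, M xi -> xi != 0 & s = rank1_hull M].
Proof.
case=> [->|[Q pQ ->]].
  exists set0; split=> //; rewrite /rank1_hull image_set0.
  apply/seteqP; split=> [_ ->|]; first exact: conic_hull0.
  by apply: conic_hull_min => // x y -> ->; rewrite addr0.
exists (minimal_vectors Q); split=> //; first exact: finite_minimal_vectors.
by move=> xi [].
Qed.

Lemma perfect_lattice_cone s : perfect_cone s -> lattice_cone s.
Proof. by move/perfect_cone_hull => [M [_ M0 sM]]; exists M. Qed.

End Forms.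

(** * The action of GL_g(Z) *)

Section Action.
Context {R : realType} {g : nat}.
Local Notation form := 'M[R]_g.
Local Notation "A ^~" := (map_mx intr A : 'M[R]_(_, _)) (at level 2, format "A ^~").
Implicit Types (Q X : form) (h k : 'M[int]_g) (s t C F : set form).
Implicit Types (b c : seq form) (o : set (seq form)).
Implicit Types (xi zeta lam : 'cV[int]_g) (M : set 'cV[int]_g).

Fact act_is_linear h : linear (act h : form -> form).
Proof.
by move=> a X Y; rewrite /act mulmxDr mulmxDl -scalemxAr -scalemxAl.
Qed.
HB.instance Definition _ h :=
  GRing.isLinear.Build R form form *:%R (act h) (act_is_linear h).

Lemma act_comp h k X : act h (act k X) = act (h *m k) X.
Proof. by rewrite /act map_mxM trmx_mul !mulmxA. Qed.

Lemma act1 X : act 1%:M X = X.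
Proof. by rewrite /act map_mx1 mul1mx trmx1 mulmx1. Qed.

Lemma actK h : h \in unitmx -> cancel (act h) (act (invmx h) : form -> form).
Proof. by move=> uh X; rewrite act_comp mulVmx // act1. Qed.

Lemma actVK h : h \in unitmx -> cancel (act (invmx h)) (act h : form -> form).
Proof. by move=> uh X; rewrite act_comp mulmxV // act1. Qed.

Lemma act_cone_comp h k s : act_cone h (act_cone k s) = act_cone (h *m k) s.
Proof.
rewrite /act_cone image_comp; apply: eq_imagel => X _ /=; exact: act_comp.
Qed.

Lemma act_cone1 s : act_cone 1%:M s = s.
Proof.
by apply: eq_image_id => X _; exact: act1.
Qed.

Lemma act_coneK h s : h \in unitmx -> act_cone (invmx h) (act_cone h s) = s.
Proof. by move=> uh; rewrite act_cone_comp mulVmx // act_cone1. Qed.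

Lemma act_coneVK h s : h \in unitmx -> act_cone h (act_cone (invmx h) s) = s.
Proof. by move=> uh; rewrite act_cone_comp mulmxV // act_cone1. Qed.

Lemma same_orbit_sym s t : same_orbit s t -> same_orbit t s.
Proof.
by move=> [h uh ->]; exists (invmx h); rewrite ?unitmx_inv // act_coneK.
Qed.

Lemma same_orbit_trans s t C : same_orbit s t -> same_orbit t C -> same_orbit s C.
Proof.
move=> [h uh ->] [k uk ->]; exists (k *m h); rewrite ?unitmx_mul ?uk //.
by rewrite act_cone_comp.
Qed.

Lemma act_rank1 h xi : act h (rank1 xi) = rank1 (h *m xi) :> form.
Proof. by rewrite /act /rank1 /lattice_vec map_mxM trmx_mul !mulmxA. Qed.

Lemma act_conic_hull h (S : set form) :
  act_cone h (conic_hull S) = conic_hull (act h @` S).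
Proof.
apply/seteqP; split=> [_ [X + <-]|].
  apply: (@conic_hull_min _ _ _ [set X | conic_hull (act h @` S) (act h X)]) => /=.
  - by rewrite linear0; exact: conic_hull0.
  - by move=> X1 X2; rewrite linearD; exact: conic_hullD.
  - move=> a Y a0 SY; rewrite linearZ; apply: conic_hullZ => //.
    by apply: conic_hull_sub; exists Y.
apply: conic_hull_min.
- by exists 0; [exact: conic_hull0|exact: linear0].
- move=> _ _ [X SX <-] [Y SY <-]; exists (X + Y); first exact: conic_hullD.
  by rewrite linearD.
- move=> a _ a0 [X SX <-]; exists (a *: X); last by rewrite linearZ.
  by apply: conic_hullZ => //; exact: conic_hull_sub.
Qed.

Lemma lattice_cone_act h s : h \in unitmx -> lattice_cone s -> lattice_cone (act_cone h s).
Proof.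
move=> uh [M [M0 ->]]; exists (mulmx h @` M); split.
  move=> _ [xi /M0 xi0 <-]; apply: contra_neq xi0 => hxi0.
  by rewrite -[xi](mulKmx uh) hxi0 mulmx0.
rewrite /rank1_hull act_conic_hull !image_comp; congr conic_hull.
by apply: eq_imagel => xi _; exact: act_rank1.
Qed.

Lemma act_cone0 h : act_cone h [set 0] = [set 0 : form].
Proof. by rewrite /act_cone image_set1 linear0. Qed.

Lemma act_cone_add h s (x : form) :
  act_cone h (cone_add s x) = cone_add (act_cone h s) (act h x).
Proof.
apply/seteqP; split.
  move=> _ [_ [y [c [sy c0 ->]]] <-]; exists (act h y), c.
  by rewrite linearD linearZ; split=> //; exists y.
move=> _ [_ [c [[y sy <-] c0 ->]]]; exists (y + c *: x).
  by exists y, c.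
by rewrite linearD linearZ.
Qed.

Lemma form_eval_act h Q (x : 'cV[R]_g) : form_eval (act h Q) x = form_eval Q (h^~^T *m x).
Proof. by rewrite /form_eval /act trmx_mul trmxK !mulmxA. Qed.

Lemma perfect_cone_act h s : h \in unitmx -> perfect_cone s -> perfect_cone (act_cone h s).
Proof.
move=> uh [->|[Q pQ ->]]; first by left; exact: act_cone0.
(* The form moves contragrediently: its new value at a vector is the old value at the preimage under
   [h], so [h] carries minimal vectors to minimal vectors. *)
right; pose k := (invmx h)^T; have uk : k \in unitmx by rewrite unitmx_tr unitmx_inv.
have ev xi : form_eval (act k Q) (lattice_vec xi) = form_eval Q (lattice_vec (invmx h *m xi)).
  by rewrite form_eval_act /k map_trmx trmxK /lattice_vec map_mxM.
exists (act k Q).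
  split=> [|x x0]; first by rewrite /act !trmx_mul trmxK pQ.1 mulmxA.
  rewrite form_eval_act; apply: pQ.2; apply: contra_neq x0 => kx0.
  rewrite -[x]mul1mx -(map_mx1 intr) -(trmx1 _ g) -(mulmxV uk) trmx_mul map_mxM.
  by rewrite -mulmxA -[map_mx _ k^T]map_trmx kx0 mulmx0.
rewrite /sigma act_conic_hull image_comp; congr conic_hull.
have minE xi : minimal_vectors (act k Q) (h *m xi) <-> minimal_vectors Q xi.
  have nz zeta (l : 'M[int]_g) : l \in unitmx -> (l *m zeta != 0) = (zeta != 0).
    move=> ul; congr (~~ _); apply/eqP/eqP => [l0|->]; last exact: mulmx0.
    by rewrite -[zeta](mulKmx ul) l0 mulmx0.
  rewrite /minimal_vectors /= nz //; split=> -[x0 mx]; split=> // zeta z0.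
    have := mx (h *m zeta); rewrite nz // => /(_ z0).
    by rewrite !ev !mulKmx.
  by rewrite !ev mulKmx //; apply: mx; rewrite nz // unitmx_inv.
apply/seteqP; split=> [_ [xi Mxi <-]|_ [xi Mxi <-]].
  by exists (h *m xi); [exact/minE|exact/esym/act_rank1].
exists (invmx h *m xi); first by apply/minE; rewrite mulKVmx.
by rewrite /= [LHS]act_rank1 mulKVmx.
Qed.

Lemma free_act h b : h \in unitmx -> free b -> free (map (act h) b).
Proof.
move=> uh /(@freeP _ _ _ (in_tuple b)) fb.
have <- : tval (map_tuple (act h) (in_tuple b)) = map (act h) b by [].
apply/freeP => a sum0; apply: fb; apply: (can_inj (actK uh)); rewrite [RHS]linear0 -[RHS]sum0.
rewrite linear_sum; apply: eq_bigr => i _; rewrite linearZ /=.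
by rewrite (nth_map 0).
Qed.

Lemma basis_act h s b : h \in unitmx -> basis_of (linear_span s) b ->
  basis_of (linear_span (act_cone h s)) (map (act h) b).
Proof.
move=> uh sb.
rewrite /basis_of (free_act uh (basis_free sb)) andbT; apply/eqP.
have f_mem (f : 'End(form)) X : X \in linear_span s ->
    (f @: linear_span s <= linear_span (act_cone h s))%VS -> f X \in linear_span (act_cone h s).
  by move=> sX /subvP; apply; exact: memv_img.
have actE X : linfun (act h) X = act h X by rewrite lfunE.
have mapE : map (act h) b = map (linfun (act h)) b by apply: eq_map => X; rewrite actE.
rewrite mapE -limg_span (span_basis sb); apply/esym/linear_span_eq => [_ [X sX <-]|W sW].
  by rewrite -actE; apply: memv_img; exact: mem_linear_span.
rewrite -(span_basis sb) limg_span -mapE; apply/span_subvP => _ /mapP[X Xb ->].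
have : X \in (linfun (act h) @^-1: W)%VS.
  apply/subvP: X {Xb} (basis_mem sb Xb); apply: linear_span_sub => Y sY.
  by rewrite -memv_preim actE; apply: sW; exists Y.
by rewrite -memv_preim actE.
Qed.

Lemma cone_dim_act h s : h \in unitmx -> cone_dim (act_cone h s) = cone_dim s.
Proof.
move=> uh; have sb := vbasisP (linear_span s).
by rewrite /cone_dim -(basis_size (basis_act uh sb)) size_map (basis_size sb).
Qed.

Lemma map_actK h b : h \in unitmx -> map (act (invmx h)) (map (act h) b) = b.
Proof. by move=> uh; apply: mapK; exact: actK. Qed.

Lemma map_actVK h b : h \in unitmx -> map (act h) (map (act (invmx h)) b) = b.
Proof. by move=> uh; apply: mapK; exact: actVK. Qed.

Lemma act_orientationE h o b : h \in unitmx -> act_orientation h o (map (act h) b) <-> o b.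
Proof.
move=> uh; split=> [[c oc /(congr1 (map (act (invmx h))))]|ob]; last by exists b.
by rewrite !map_actK // => <-.
Qed.

Lemma act_orientation_comp h k o :
  act_orientation h (act_orientation k o) = act_orientation (h *m k) o.
Proof.
rewrite /act_orientation image_comp; apply: eq_imagel => b _ /=.
by rewrite -map_comp; apply: eq_map => X; exact: act_comp.
Qed.

Lemma act_orientation1 o : act_orientation 1%:M o = o.
Proof.
apply: eq_image_id => b _.
by rewrite -[RHS]map_id; apply: eq_map => X; exact: act1.
Qed.

Lemma basis_change_det_act h s b c : h \in unitmx ->
  basis_of (linear_span s) b -> basis_of (linear_span s) c ->
  basis_change_det (map (act h) b) (map (act h) c) = basis_change_det b c.
Proof.
move=> uh sb sc; apply: (basis_change_det_map sb sc).
exact: free_act uh (basis_free sb).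
Qed.

Lemma orientation_act h s o : h \in unitmx -> orientation (linear_span s) o ->
  orientation (linear_span (act_cone h s)) (act_orientation h o).
Proof.
move=> uh so; split=> [_ [b ob <-]|b c].
  by apply: basis_act => //; exact: so.1.
rewrite -[b](map_actVK _ uh) -[c](map_actVK _ uh) => hb hc.
have uv : invmx h \in unitmx by rewrite unitmx_inv.
have := basis_act uv hb; have := basis_act uv hc.
rewrite !act_coneK // !map_actK // => sc sb.
rewrite !act_orientationE // (basis_change_det_act uh sb sc).
exact: so.2.
Qed.

Lemma face_act h C F : h \in unitmx -> face C F -> face (act_cone h C) (act_cone h F).
Proof.
move=> uh [l [l0 FE]].
have [l' l'E] : exists l' : {scalar form}, forall X, l' X = l (act (invmx h) X).
  by apply: scalar_exists => a X Y; rewrite !linearD !linearZ.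
exists l'; split=> [_ [X CX <-]|]; first by rewrite l'E actK // l0.
apply/seteqP; split=> [_ [X + <-]|_ [[X CX <-]]].
  by rewrite FE => -[CX lX]; split; [exists X|rewrite l'E actK].
by rewrite l'E actK // => lX; exists X; rewrite // FE.
Qed.

Lemma facet_act h C F : h \in unitmx -> facet C F ->
  facet (act_cone h C) (act_cone h F).
Proof. by move=> uh [Ff dF]; split; [exact: face_act|rewrite !cone_dim_act]. Qed.

Lemma ray_generator_act h C X : h \in unitmx -> ray_generator C X ->
  ray_generator (act_cone h C) (act h X).
Proof.
move=> uh [X0 ray]; split.
  by apply: contra_neq X0 => X0; rewrite -[X](actK uh) X0 linear0.
have := face_act uh ray; congr (face _ _); apply/seteqP; split.
  by move=> _ [_ [a a0 ->] <-]; exists a; rewrite ?linearZ.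
by move=> _ [a a0 ->]; exists (a *: X); rewrite ?linearZ //; exists a.
Qed.

Lemma induced_orientation_act h C F o : h \in unitmx ->
  act_orientation h (induced_orientation C F o) =
  induced_orientation (act_cone h C) (act_cone h F) (act_orientation h o).
Proof.
have sub k C' F' o' : k \in unitmx ->
  act_orientation k (induced_orientation C' F' o') `<=`
  induced_orientation (act_cone k C') (act_cone k F') (act_orientation k o').
  move=> uk _ [b [Fb [v [Cv nFv ov]]] <-]; split; first exact: basis_act.
  exists (act k v); split; first exact: ray_generator_act.
    move=> [w Fw /(can_inj (actK uk)) wv]; apply: nFv; by rewrite -wv.
  by rewrite -map_rcons act_orientationE.
move=> uh; apply/seteqP; split; first exact: sub.
have uv : invmx h \in unitmx by rewrite unitmx_inv.
move=> b Hb; have : act_orientation (invmx h) (induced_orientation (act_cone h C) (act_cone h F) (act_orientation h o)) (map (act (invmx h)) b) by exists b.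
move/(sub _ _ _ _ uv); rewrite !act_coneK // act_orientation_comp mulVmx // act_orientation1.
by move=> H; exists (map (act (invmx h)) b); rewrite ?map_actVK.
Qed.

(** With [det_alternating], this replaces orientations by the sign of the determinant of each
    stabilizing element on one basis. *)
Lemma alternating_det s h b : alternating s -> h \in unitmx -> act_cone h s = s ->
  basis_of (linear_span s) b -> 0 < basis_change_det b (map (act h) b).
Proof.
move=> [_ alt] uh hs sb; have [o so] := orientation_exists (linear_span s).
have sc : basis_of (linear_span s) (map (act h) b) by rewrite -{1}hs; exact: basis_act.
apply/(so.2 _ _ sb sc).
by rewrite -{2}(alt h uh hs o so) act_orientationE.
Qed.

Lemma det_alternating s b : perfect_cone s -> basis_of (linear_span s) b ->
  (forall h, h \in unitmx -> act_cone h s = s ->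
     0 < basis_change_det b (map (act h) b)) -> alternating s.
Proof.
move=> ps sb pos; split=> // h uh hs o so.
have sc : basis_of (linear_span s) (map (act h) b) by rewrite -{1}hs; exact: basis_act.
have so' : orientation (linear_span s) (act_orientation h o).
  by rewrite -{1}hs; exact: orientation_act.
apply/(orientation_eqP so' so sc); rewrite act_orientationE //.
exact: (orientation_transfer so sb sc (pos h uh hs)).
Qed.

Lemma alternating_act h s : h \in unitmx -> alternating s -> alternating (act_cone h s).
Proof.
move=> uh alt; have sb := vbasisP (linear_span s); set b := vbasis _ in sb.
apply: (det_alternating _ (basis_act uh sb)).
  by apply: perfect_cone_act alt.1.
move=> k uk khs; pose j := invmx h *m k *m h.
have uj : j \in unitmx by rewrite !unitmx_mul unitmx_inv uh uk.
have js : act_cone j s = s by rewrite -!act_cone_comp khs act_coneK.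
have -> : map (act k) (map (act h) b) = map (act h) (map (act j) b).
  by rewrite -!map_comp; apply: eq_map => X /=; rewrite !act_comp /j !mulmxA mulmxV // mul1mx.
have sc : basis_of (linear_span s) (map (act j) b) by rewrite -{1}js; exact: basis_act.
rewrite (basis_change_det_act uh sb sc); exact: (alternating_det alt uj js sb).
Qed.

Lemma alternating_same_orbit s t : same_orbit s t -> alternating s -> alternating t.
Proof. by move=> [h uh ->]; exact: alternating_act. Qed.

End Action.

(** * Coloops *)

Section Coloops.
Context {R : realType} {g : nat}.
Local Notation form := 'M[R]_g.
Local Notation "A ^~" := (map_mx intr A : 'M[R]_(_, _)) (at level 2, format "A ^~").
Implicit Types (Q X Y : form) (h k : 'M[int]_g) (s t : set form).
Implicit Types (xi zeta lam : 'cV[int]_g) (M : set 'cV[int]_g).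

Definition dual_pairing lam xi : int := (lam^T *m xi) 0 0.

Lemma dual_pairingC lam xi : dual_pairing lam xi = dual_pairing xi lam.
Proof. by rewrite /dual_pairing -[xi in LHS]trmxK -trmx_mul mxE. Qed.

Lemma rank1_mul xi zeta : rank1 xi *m lattice_vec zeta =
  (dual_pairing zeta xi)%:~R *: (lattice_vec xi : 'cV[R]_g).
Proof.
rewrite /rank1 -mulmxA /lattice_vec map_trmx -map_mxM [xi^T *m zeta]mx11_scalar.
rewrite map_scalar_mx mul_mx_scalar /dual_pairing; congr (_%:~R *: _).
by rewrite -[zeta in LHS]trmxK -trmx_mul mxE.
Qed.

Lemma form_eval_rank1_lattice xi lam :
  form_eval (rank1 xi) (lattice_vec lam) = (dual_pairing lam xi)%:~R ^+ 2 :> R.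
Proof.
rewrite /form_eval -mulmxA rank1_mul -scalemxAr mxE /lattice_vec map_trmx -map_mxM.
by rewrite mxE -/(dual_pairing _ _) expr2.
Qed.

(* xi is a coloop of s + R>=0 xi xi^t: the functional lam splits Z^g as
   Z xi + ker lam, and the vectors spanning the forms of s lie in ker lam. *)
Definition coloop s xi lam : Prop :=
  dual_pairing lam xi = 1 /\ forall X, s X -> X *m lattice_vec lam = 0.

Definition inflates s t : Prop :=
  exists xi lam, coloop s xi lam /\ t = cone_add s (rank1 xi).

Definition coloop_free t : Prop := ~ exists s, inflates s t.

(** Evaluation of forms at [lam] is the functional assumed in the results on adding a ray; on a rank
    one form it is the square of the pairing. *)
Lemma coloop_functional s xi lam : coloop s xi lam ->
  exists m : {scalar form}, [/\ forall X, m X = form_eval X (lattice_vec lam),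
    forall X, s X -> m X = 0 & m (rank1 xi) = 1].
Proof.
move=> [lx sl]; have [m mE] := form_eval_scalar (lattice_vec lam : 'cV[R]_g).
exists m; split=> // [X sX|]; rewrite mE.
  by rewrite /form_eval -mulmxA sl // mulmx0 mxE.
by rewrite form_eval_rank1_lattice lx expr1n.
Qed.

Lemma coloop_neq0 s xi lam : coloop s xi lam -> xi != 0.
Proof.
move=> [lx _]; apply: contra_eq_neq lx => ->.
by rewrite /dual_pairing mulmx0 mxE eq_sym oner_eq0.
Qed.

Lemma inflated0 s xi lam : coloop s xi lam ->
  perfect_cone (cone_add s (rank1 xi)) -> s 0.
Proof.
move=> /coloop_functional[m [_ ms mx]] /perfect_lattice_cone/lattice_cone0.
move/(cone_add_scalar ms mx) => -[_]; by rewrite linear0 scale0r subr0.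
Qed.

(* If t = sigma Q, then s is generated by the minimal vectors of Q on which lam
   vanishes, and these are the minimal vectors of Q + lam lam^t. *)
Lemma inflates_perfect s t : inflates s t -> perfect_cone t -> perfect_cone s.
Proof.
move=> [xi [lam [cl tE]]] pt; rewrite tE in pt.
have s0 := inflated0 cl pt.
have [m [mE ms mx]] := coloop_functional cl.
case: pt => [t0|[Q pQ tQ]].
  have : [set 0] (rank1 xi : form) by rewrite -t0; exact: mem_cone_add.
  by move=> /= x0; move: mx; rewrite x0 linear0 => /eqP; rewrite eq_sym oner_eq0.
pose M := [set zeta | minimal_vectors Q zeta /\ dual_pairing lam zeta = 0].
have sM : s = rank1_hull M.
  rewrite (cone_add_section (x := rank1 xi) ms mx) tQ /sigma conic_hull_face.
    congr conic_hull; apply/seteqP; split.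
      move=> _ [[zeta Mz <-]]; rewrite mE -/(rank1 zeta) form_eval_rank1_lattice.
      move/eqP; rewrite expf_eq0 /= intr_eq0 => /eqP lz.
      by exists zeta.
    move=> _ [zeta [Mz lz] <-]; split; first by exists zeta.
    by rewrite mE form_eval_rank1_lattice lz expr0n.
  by move=> _ [zeta _ <-]; rewrite mE -/(rank1 zeta) form_eval_rank1_lattice sqr_ge0.
(* If no minimal vector pairs to zero with [lam], the base is the zero cone, perfect by convention.
   Otherwise [zeta0] shows that the minimum of the modified form is still that of [Q]. *)
have [M0|/set0P[zeta0 [[z0 min0] lz0]]] := eqVneq M set0.
  left; rewrite sM M0 /rank1_hull image_set0; apply/seteqP; split=> [|_ ->].
    by apply: conic_hull_min => // x y -> ->; rewrite addr0.
  exact: conic_hull0.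
right; exists (Q + rank1 lam).
  have Q'E x : form_eval (Q + rank1 lam) x = form_eval Q x + form_eval (rank1 lam) x.
    by rewrite /form_eval mulmxDr mulmxDl mxE.
  split=> [|x x0]; first by rewrite linearD /= rank1_tr pQ.1.
  by rewrite Q'E form_eval_rank1 ltr_wpDr ?sqr_ge0 // pQ.2.
have Q'E zeta : form_eval (Q + rank1 lam) (lattice_vec zeta) =
    form_eval Q (lattice_vec zeta) + (dual_pairing lam zeta)%:~R ^+ 2.
  rewrite -form_eval_rank1_lattice form_eval_rank1 bilinC ?trmx1 // -form_eval_rank1.
  by rewrite /form_eval mulmxDr mulmxDl mxE.
rewrite sM; congr conic_hull; congr image.
apply/seteqP; split=> zeta.
  move=> [[zn0 minz] lz]; split=> // zeta' z'0.
  by rewrite !Q'E lz expr0n addr0; apply: ler_wpDr; rewrite ?sqr_ge0 // minz.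
move=> [zn0 minz]; have := minz _ z0; rewrite !Q'E lz0 expr0n addr0 => le0.
have le1 := min0 _ zn0.
have sq0 := sqr_ge0 ((dual_pairing lam zeta)%:~R : R).
split; last first.
  apply/eqP; rewrite -(intr_eq0 R) -sqrf_eq0 eq_le sq0 andbT.
  by move: le0 le1 sq0; lra.
split=> // zeta' z'0; apply: le_trans (min0 _ z'0).
by move: le0 sq0; lra.
Qed.

(** Write the second rank one form as X + c x with X in [s]. If c = 0 it lies in [s] and is a coloop
    there, which is excluded. If not, applying both sides to [lam] shows that the two vectors are
    proportional, and integrality leaves only a sign. *)
Lemma coloop_unique s s1 xi xi1 lam lam1 : coloop s xi lam -> coloop s1 xi1 lam1 ->
    perfect_cone (cone_add s (rank1 xi)) -> coloop_free s ->
    cone_add s (rank1 xi) = cone_add s1 (rank1 xi1) ->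
  s1 = s /\ rank1 xi1 = rank1 xi :> form.
Proof.
move=> cl cl1 pt sfree tE.
have pt1 : perfect_cone (cone_add s1 (rank1 xi1)) by rewrite -tE.
have ps : perfect_cone s by apply: (@inflates_perfect s _ _ pt); exists xi, lam.
have [s0 s10] := (inflated0 cl pt, inflated0 cl1 pt1).
have [m [mE ms mx]] := coloop_functional cl.
have [m1 [m1E ms1 mx1]] := coloop_functional cl1.
have [X [c [sX c0 x1E]]] : cone_add s (rank1 xi) (rank1 xi1).
  by rewrite tE; exact: mem_cone_add.
have [c_eq0|cn0] := eqVneq c 0.
  case: sfree; exists [set X | s X /\ m1 X = 0].
  have sx1 : s (rank1 xi1) by rewrite x1E c_eq0 scale0r addr0.
  exists xi1, lam1; split; first split; first exact: cl1.1.
    move=> Y [sY m1Y]; apply: cl1.2.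
    rewrite (cone_add_section (x := rank1 xi1) ms1 mx1) -tE; split=> //.
    exact: cone_add_sub.
  apply/seteqP; split=> [Y sY|_ [Y [d [[sY _] d0 ->]]]]; last first.
    have ls := perfect_lattice_cone ps.
    by apply: (lattice_coneD ls) => //; exact: lattice_coneZ.
  have : cone_add s1 (rank1 xi1) Y by rewrite -tE; exact: cone_add_sub.
  move=> [Z [d [sZ d0 YE]]]; exists Z, d; split=> //; split; last exact: ms1.
  rewrite (cone_add_section (x := rank1 xi) ms mx) tE; split.
    exact: cone_add_sub.
  by move: (ms _ sY); rewrite YE linearD linearZ /= (ms _ sx1) mulr0 addr0.
have x1x : rank1 xi1 = rank1 xi :> form.
  pose n := dual_pairing lam xi1; pose p := dual_pairing lam1 xi.
  have nx : n%:~R *: lattice_vec xi1 = c *: (lattice_vec xi : 'cV[R]_g).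
    rewrite -rank1_mul x1E mulmxDl cl.2 // add0r -scalemxAl rank1_mul cl.1.
    by rewrite scale1r.
  have pair l x : ((lattice_vec l)^T *m lattice_vec x) 0 0 = (dual_pairing l x)%:~R :> R.
    by rewrite /lattice_vec map_trmx -map_mxM mxE.
  have dot l : n%:~R * (dual_pairing l xi1)%:~R = c * (dual_pairing l xi)%:~R :> R.
    have := congr1 (fun v : 'cV[R]_g => ((lattice_vec l)^T *m v) 0 0) nx.
    have ZE b (A : 'M[R]_1) : (b *: A) 0 0 = b * A 0 0 by rewrite mxE.
    by rewrite -!scalemxAr !ZE !pair.
  (* Pairing with [lam] gives c = n^2; pairing with [lam1] then gives n p = 1 over the integers, so
     n is 1 or -1. *)
  have := dot lam; rewrite cl.1 mulr1 -/n => nn.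
  have := dot lam1; rewrite cl1.1 mulr1 -/p -nn => np.
  have n0 : (n%:~R : R) != 0 by apply: contra_neq cn0 => n0; rewrite -nn n0 mulr0.
  have np1 : n * p = 1.
    apply: (@intr_inj R); rewrite intrM; apply: (mulfI n0).
    by rewrite mulrA -np mulr1.
  have n1 : (n%:~R : R) * n%:~R = 1.
    rewrite -intrM -[RHS]/(1%:~R); congr _%:~R.
    have /eqP := congr1 absz np1; rewrite abszM muln_eq1 => /andP[/eqP absn _].
    by have [->|->] : n = 1 \/ n = -1 by lia.
  have xE : lattice_vec xi1 = n%:~R *: (lattice_vec xi : 'cV[R]_g).
    by apply: (scalerI n0); rewrite nx scalerA -nn.
  by rewrite /rank1 xE linearZ -scalemxAl -scalemxAr scalerA n1 scale1r.
split=> //; rewrite x1x in tE mx1.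
have half u v (a : {scalar form}) : (forall Y, u Y -> a Y = 0) -> a (rank1 xi) = 1 ->
    cone_add u (rank1 xi) = cone_add v (rank1 xi) -> u `<=` v.
  move=> au ax uv Y uY.
  have [Z [d [vZ d0 YE]]] : cone_add v (rank1 xi) Y by rewrite -uv; exact: cone_add_sub.
  have [aZ _] : 0 <= a Z /\ u (Z - a Z *: rank1 xi).
    by apply: (cone_add_scalar au ax); rewrite uv; exact: cone_add_sub.
  have := au _ uY; rewrite YE linearD linearZ /= ax mulr1 => /eqP.
  by rewrite paddr_eq0 // => /andP[_ /eqP ->]; rewrite scale0r addr0.
by apply/seteqP; split; [exact: (half _ _ m1 ms1 mx1 (esym tE))|exact: (half _ _ m ms mx tE)].
Qed.

Lemma act_eq_span h k s : (forall X, s X -> act h X = act k X) ->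
  forall X, X \in linear_span s -> act h X = act k X.
Proof.
move=> hk X; pose f : 'End(form) := (linfun (act h) - linfun (act k))%VF.
have : (linear_span s <= lker f)%VS.
  apply: linear_span_sub => Y sY.
  by rewrite memv_ker add_lfunE opp_lfunE !lfunE /= hk // subrr.
move/subvP => sub /sub; rewrite memv_ker add_lfunE opp_lfunE !lfunE /= subr_eq0.
by move/eqP.
Qed.

Lemma map_act_eq h k s b : (forall X, s X -> act h X = act k X) ->
  basis_of (linear_span s) b -> map (act h) b = map (act k) b.
Proof.
move=> hk sb; apply/eq_in_map => X Xb.
exact: act_eq_span hk _ (basis_mem sb Xb).
Qed.

Lemma cone_addC s (x y : form) : cone_add (cone_add s x) y = cone_add (cone_add s y) x.
Proof.
have sub u v : cone_add (cone_add s u) v `<=` cone_add (cone_add s v) u.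
  move=> _ [_ [c [[X [d [sX d0 ->]]] c0 ->]]].
  by exists (X + c *: v), d; rewrite addrAC; split=> //; exists X, c.
by apply/seteqP; split; exact: sub.
Qed.

(* The reflection exchanging the two coloops reverses the orientation. *)
Lemma two_coloops_not_alternating s t : inflates s t -> alternating t -> coloop_free s.
Proof.
move=> [xi [lam [cl ->]]] alt [s' [xi' [lam' [cl' sE]]]].
have pt := alt.1.
have ps : perfect_cone s by apply: (@inflates_perfect s _ _ pt); exists xi, lam.
have s0 := lattice_cone0 (perfect_lattice_cone ps).
have s'0 : s' 0 by apply: (inflated0 cl'); rewrite -sE.
have s's : s' `<=` s by rewrite sE; exact: cone_add_sub.
have sx' : s (rank1 xi') by rewrite sE; exact: mem_cone_add.
have [m [mE ms mx]] := coloop_functional cl.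
have [m' [m'E ms' mx']] := coloop_functional cl'.
have lx' : dual_pairing lam xi' = 0.
  apply/eqP; rewrite -(intr_eq0 R) -sqrf_eq0 -form_eval_rank1_lattice -mE.
  by rewrite ms.
(* The functional [lam'] need not vanish at [xi]; after this correction [lam], [lam2] are dual to
   [xi], [xi']. *)
pose a := dual_pairing lam' xi; pose lam2 := lam' - a *: lam.
have pairB l1 l2 x : dual_pairing (l1 - l2) x = dual_pairing l1 x - dual_pairing l2 x.
  by rewrite /dual_pairing linearB /= mulmxBl !mxE.
have pairZ b l x : dual_pairing (b *: l) x = b * dual_pairing l x.
  by rewrite /dual_pairing linearZ /= -scalemxAl mxE.
have l2x : dual_pairing lam2 xi = 0 by rewrite pairB pairZ cl.1 mulr1 subrr.
have l2x' : dual_pairing lam2 xi' = 1 by rewrite pairB pairZ lx' mulr0 subr0 cl'.1.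
pose u := xi - xi'; pose w := lam - lam2.
have w_mul x : w^T *m x = (dual_pairing w x)%:M by rewrite [LHS]mx11_scalar.
have wx : dual_pairing w xi = 1 by rewrite pairB cl.1 l2x subr0.
have wx' : dual_pairing w xi' = -1 by rewrite pairB lx' l2x' sub0r.
have wu : w^T *m u = 2%:M.
  by rewrite mulmxBr !w_mul wx wx' -raddfB.
(* Since [w] pairs to 2 with [u], this is an integral reflection. It fixes the forms of [s'] because
   [w] annihilates them. *)
pose h : 'M[int]_g := 1%:M - u *m w^T.
have hh : h *m h = 1%:M.
  have pp : (u *m w^T) *m (u *m w^T) = u *m w^T + u *m w^T.
    by rewrite mulmxA -[u *m _ *m u]mulmxA wu mul_mx_scalar -scalemxAl scaler_nat.
  by rewrite /h mulmxBl mul1mx mulmxBr mulmx1 pp opprB addrK subrK.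
have uh : h \in unitmx by have [] := mulmx1_unit hh.
have hx : h *m xi = xi'.
  by rewrite /h mulmxBl mul1mx -mulmxA w_mul wx mulmx1 /u opprB addrC subrK.
have hx' : h *m xi' = xi.
  by rewrite -hx mulmxA hh mul1mx.
have hs' X : s' X -> act h X = act 1%:M X.
  move=> s'X; rewrite act1 /act.
  have Xw : X *m (lattice_vec w) = 0.
    have lvB (p q : 'cV[int]_g) : lattice_vec (p - q) = lattice_vec p - lattice_vec q :> 'cV[R]_g.
      exact: map_mxB.
    rewrite !lvB !mulmxBr (cl.2 _ (s's _ s'X)) (cl'.2 _ s'X) /lattice_vec map_mxZ.
    by rewrite -scalemxAr (cl.2 _ (s's _ s'X)) scaler0 !subr0.
  have XT := lattice_cone_tr (perfect_lattice_cone ps) (s's _ s'X).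
  have wX : w^~^T *m X = 0 by rewrite -XT -trmx_mul Xw trmx0.
  have hX : h^~ *m X = X.
    by rewrite map_mxB map_mx1 map_mxM -map_trmx mulmxBl mul1mx -mulmxA wX mulmx0 subr0.
  by rewrite hX -{1}XT -trmx_mul hX XT.
have hs : act_cone h s' = s'.
  apply: eq_image_id => X s'X; by rewrite hs' // act1.
have ht : act_cone h (cone_add s (rank1 xi)) = cone_add s (rank1 xi).
  by rewrite sE !act_cone_add hs !act_rank1 hx hx' cone_addC.
have sb := vbasisP (linear_span s'); set b := vbasis _ in sb.
have tb : basis_of (linear_span (cone_add s (rank1 xi))) (rcons (rcons b (rank1 xi')) (rank1 xi)).
  apply: (basis_cone_add s0 ms mx); rewrite sE.
  exact: basis_cone_add ms' mx' _ sb.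
have := alternating_det alt uh ht tb.
rewrite !map_rcons (map_act_eq hs' sb) (eq_map act1) map_id !act_rank1 hx hx'.
by rewrite basis_change_det_swap ?ltr0N1 ?ltrN10 // ?(basis_free tb) // ltr0N1.
Qed.

End Coloops.

(** * Inflation *)

Section Saturation.
Implicit Types (g d r : nat).

(** For unimodular [T], the projector onto the span of the first [r] columns of [T] along the other
    columns; its image is a direct summand. *)
Definition conj_pid g (T : 'M[int]_g) r : 'M[int]_g := T *m pid_mx r *m invmx T.

Lemma pid_mulmxE (K : pzSemiRingType) m n r (B : 'M[K]_(m, n)) i j :
  ((pid_mx r : 'M_m) *m B) i j = B i j *+ (i < r).
Proof.
rewrite mxE (bigD1 i) //= big1 ?addr0 => [|k ki].
  by rewrite mxE eqxx /=; case: ltnP; rewrite ?mul1r ?mul0r.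
by rewrite mxE val_eqE eq_sym (negPf ki) mul0r.
Qed.

Lemma mulmx_pidE (K : pzSemiRingType) m n r (B : 'M[K]_(m, n)) i j :
  (B *m (pid_mx r : 'M_n)) i j = B i j *+ (j < r).
Proof.
rewrite mxE (bigD1 j) //= big1 ?addr0 => [|k kj].
  by rewrite mxE eqxx /=; case: ltnP; rewrite ?mulr1 ?mulr0.
by rewrite mxE val_eqE (negPf kj) mulr0.
Qed.

(* The columns of A span a finite index subgroup of the image of conj_pid T r. *)
Lemma saturation_projector g d (A : 'M[int]_(g, d)) :
  exists T r, [/\ T \in unitmx, (r <= d)%N, (r <= g)%N, conj_pid T r *m A = A &
    forall n (N : 'M[int]_(n, g)), N *m A = 0 -> N *m conj_pid T r = 0].
Proof.
have [T uT [S uS [c csorted ->]]] := int_Smith_normal_form A.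
set D := \matrix_(i, j) _.
(* Sorted by divisibility, the zeros of [c] come last, so the index counts the nonzero invariant
   factors; the minimum drops entries outside the matrix. *)
pose r := minn (index 0%R c) (minn g d).
exists T, r; split; rewrite ?geq_min ?leqnn ?orbT //.
  rewrite /conj_pid !mulmxA mulmxKV //; congr (_ *m _).
  rewrite -[LHS]mulmxA; congr (_ *m _); apply/matrixP => i j.
  rewrite pid_mulmxE mxE; case: ltnP => // ri; rewrite mulr0n.
  have [ij|_] := eqVneq; rewrite ?mulr0n // mulr1n.
  have ci : (index 0%R c <= i)%N.
    by move: ri; rewrite /r; have := ltn_ord i; have := ltn_ord j; rewrite ij; lia.
  have [ic|ic] := ltnP i (size c); last by rewrite nth_default.
  have c0 : c`_(index 0%R c) = 0 by rewrite nth_index // -index_mem (leq_ltn_trans ci).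
  have dvT : @transitive int dvdz by move=> ? ? ?; exact: dvdz_trans.
  have dvR : @reflexive int dvdz by exact: dvdzz.
  have := sorted_leq_nth dvT dvR 0 csorted.
  move=> /(_ (index 0%R c) i); rewrite !inE (leq_ltn_trans ci ic) ic => /(_ isT isT ci).
  by rewrite c0 => /dvdzP[q ->]; rewrite mulr0.
move=> n N; rewrite /conj_pid !mulmxA => NA.
have {NA} ND : N *m T *m D = 0 by rewrite -[LHS](mulmxK uS) NA mul0mx.
suff -> : N *m T *m (pid_mx r : 'M_g) = 0 by rewrite mul0mx.
apply/matrixP => i j; rewrite mulmx_pidE [RHS]mxE.
case: ltnP => [jr|_]; rewrite ?mulr0n // mulr1n.
have jd : (j < d)%N by move: jr; rewrite /r; lia.
have cj : c`_j != 0.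
  have jc : (j < index 0%R c)%N by move: jr; rewrite /r; lia.
  by apply/negbT; exact: (before_find 0 jc).
move/matrixP/(_ i (Ordinal jd)): ND; rewrite mxE [RHS]mxE (bigD1 j) //= big1 ?addr0.
  by rewrite [D _ _]mxE eqxx mulr1n => /eqP; rewrite mulf_eq0 (negPf cj) orbF => /eqP.
by move=> k kj; rewrite [D _ _]mxE val_eqE (negPf kj) mulr0n mulr0.
Qed.

(** The trace recovers the rank, which is how the ranks of two equivalent lattices are compared. *)
Lemma mxtrace_conj_pid g (T : 'M[int]_g) r : T \in unitmx -> (r <= g)%N ->
  \tr (conj_pid T r) = r%:Z.
Proof.
move=> uT rg; rewrite /conj_pid mxtrace_mulC mulmxA mulVmx // mul1mx /mxtrace.
under eq_bigr => i _ do rewrite mxE eqxx /=.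
rewrite -natr_sum -big_mkcond /= natz.
by rewrite -(big_ord_widen g (fun=> 1%N) rg) sum1_card card_ord.
Qed.

Lemma conj_pid_idem g (T : 'M[int]_g) r : T \in unitmx -> (r <= g)%N ->
  conj_pid T r *m conj_pid T r = conj_pid T r.
Proof.
move=> uT rg; rewrite /conj_pid !mulmxA mulmxKV //; congr (_ *m _).
by rewrite -mulmxA pid_mx_id.
Qed.

End Saturation.

Section Inflation.
Context {R : realType} {g : nat}.
Local Notation form := 'M[R]_g.
Local Notation "A ^~" := (map_mx intr A : 'M[R]_(_, _)) (at level 2, format "A ^~").
Implicit Types (Q X Y : form) (h k : 'M[int]_g) (s t : set form).
Implicit Types (xi zeta lam : 'cV[int]_g) (M : set 'cV[int]_g).

(** Take a longest list with linearly independent rank one forms. It is finite even if [M] is not,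
    and its length bounds the rank of the lattice by the dimension of the cone. *)
Lemma rank1_hull_basis M : exists L : seq 'cV[int]_g,
  [/\ forall xi, xi \in L -> M xi, (size L <= cone_dim (rank1_hull M : set form))%N &
      forall X, rank1_hull M X -> X \in <<map rank1 L>>%VS].
Proof.
pose good n := `[< exists L : seq 'cV[int]_g, [/\ forall xi, xi \in L -> M xi,
  free (map rank1 L : seq form) & size L = n] >].
have good0 : exists n, good n.
  by exists 0%N; apply/asboolP; exists [::]; split=> //=; exact: nil_free.
have good_le n : good n -> (n <= \dim {:form})%N.
  move=> /asboolP[L [_ fL <-]]; rewrite -(size_map (rank1 : _ -> form)).
  by move: fL; rewrite /free => /eqP <-; rewrite dimvS ?subvf.
case: (ex_maxnP good0 good_le) => n /asboolP[L [LM fL sL]] nmax.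
exists L; split=> //.
  rewrite -(size_map (rank1 : _ -> form)); move: fL; rewrite /free => /eqP <-.
  apply: dimvS; apply/span_subvP => _ /mapP[xi /LM Mxi ->].
  by apply: mem_linear_span; apply: conic_hull_sub; exists xi.
apply: conic_hull_min => /=.
- exact: mem0v.
- by move=> Y Z; exact: memvD.
- move=> a _ _ [xi Mxi <-]; apply: memvZ; apply/negPn/negP => nL.
  have /nmax : good n.+1.
    apply/asboolP; exists (xi :: L); split; rewrite /= ?sL ?free_cons ?nL //.
    by move=> zeta; rewrite inE => /orP[/eqP -> //|]; exact: LM.
  by rewrite ltnn.
Qed.

(** The form maps [xi] to a nonzero multiple of itself, the factor being its squared length. *)
Lemma mul_rank1_eq0 n (N : 'M[R]_(n, g)) xi : xi != 0 ->
  N *m rank1 xi = 0 -> N *m lattice_vec xi = 0.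
Proof.
move=> xi0 /(congr1 (fun B => B *m lattice_vec xi)); rewrite mul0mx -mulmxA rank1_mul -scalemxAr.
move/eqP; rewrite scaler_eq0 => /orP[|/eqP //].
rewrite -(sqrf_eq0) -form_eval_rank1_lattice form_eval_rank1 sqrf_eq0.
by have := positive_definite1.2 _ (lattice_vec_neq0 (R := R) xi0) => /gt_eqF ->.
Qed.

(** The image of the projector is the saturation of a lattice whose rank one forms span those of
    [s]. The last property extends integral identities from [s] to this summand. *)
Lemma lattice_cone_projector s : lattice_cone s -> exists T r,
  [/\ T \in unitmx, (r <= cone_dim s)%N, (r <= g)%N,
    forall X, s X -> (conj_pid T r)^~ *m X = X &
    forall n (N : 'M[int]_(n, g)), (forall X, s X -> N^~ *m X = 0) ->
      N *m conj_pid T r = 0].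
Proof.
move=> [M [M0 ->]].
have [L [LM sL spanL]] := rank1_hull_basis M.
pose A : 'M[int]_(g, size L) := \matrix_(i, j) L`_j i 0.
have colA j : col j A = L`_j by apply/matrixP => i k; rewrite ord1 !mxE.
have mulA n (N : 'M[int]_(n, g)) j : col j (N *m A) = N *m L`_j.
  by rewrite -colA !colE mulmxA.
have [T [r [uT rd rg PA NA]]] := saturation_projector A.
exists T, r; split=> //; first exact: leq_trans sL.
  have PL xi : xi \in L -> conj_pid T r *m xi = xi.
    move=> xiL; have iL : (index xi L < size L)%N by rewrite index_mem.
    by have := mulA _ (conj_pid T r) (Ordinal iL); rewrite PA colA /= nth_index.
  have PX xi : xi \in L -> (conj_pid T r)^~ *m rank1 xi = rank1 xi.
    by move=> /PL Pxi; rewrite /rank1 mulmxA /lattice_vec -map_mxM Pxi.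
  move=> X /spanL XL; rewrite (coord_span (X := in_tuple (map rank1 L)) XL).
  rewrite mulmx_sumr; apply: eq_bigr => i _; rewrite -scalemxAr; congr (_ *: _) => /=.
  by have := ltn_ord i; rewrite [X in (_ < X)%N]size_map => iL; rewrite (nth_map 0) // PX // mem_nth.
move=> n N Ns; apply: NA; apply/matrixP => i j.
have : N *m L`_j = 0.
  have Mj : M L`_j by apply: LM; exact: mem_nth.
  apply: (@intmx_inj R); rewrite map_mx0 map_mxM; apply: mul_rank1_eq0 (M0 _ Mj) _.
  by apply: Ns; apply: conic_hull_sub; exists L`_j.
by rewrite -mulA => /matrixP/(_ i 0); rewrite !mxE.
Qed.

Lemma coloop_act s xi lam h : h \in unitmx -> coloop s xi lam ->
  coloop (act_cone h s) (h *m xi) ((invmx h)^T *m lam).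
Proof.
move=> uh [lx sl]; split.
  by rewrite /dual_pairing trmx_mul trmxK mulmxA mulmxKV.
move=> _ [X sX <-]; rewrite /act /lattice_vec map_mxM -!mulmxA [_^T *m (_ *m _)]mulmxA.
by rewrite map_trmx -map_mxM -trmx_mul mulVmx // trmx1 map_mx1 mul1mx sl // mulmx0.
Qed.

Lemma inflates_act s t h : h \in unitmx -> inflates s t ->
  inflates (act_cone h s) (act_cone h t).
Proof.
move=> uh [xi [lam [cl ->]]]; exists (h *m xi), ((invmx h)^T *m lam).
by split; [exact: coloop_act|rewrite act_cone_add act_rank1].
Qed.

Lemma coloop_free_act s h : h \in unitmx -> coloop_free s -> coloop_free (act_cone h s).
Proof.
move=> uh sf [s' /(inflates_act (h := invmx h))]; rewrite unitmx_inv => /(_ uh).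
by rewrite act_coneK // => H; apply: sf; exists (act_cone (invmx h) s').
Qed.

Lemma coloop_free_same_orbit s t : same_orbit s t -> coloop_free s -> coloop_free t.
Proof. by move=> [h uh ->]; exact: coloop_free_act. Qed.

End Inflation.

(** * Extending equivalences of cones over a coloop *)

Section Equivalence.
Context {R : realType} {g : nat}.
Local Notation form := 'M[R]_g.
Local Notation "A ^~" := (map_mx intr A : 'M[R]_(_, _)) (at level 2, format "A ^~").
Implicit Types (Q X Y : form) (h k : 'M[int]_g) (s t : set form).
Implicit Types (xi zeta lam : 'cV[int]_g) (M : set 'cV[int]_g).

(* p and xi *m l are the projectors onto the first two summands of
   Z^g = L + Z xi + K, where L is the saturation of the lattice spanned by s. *)
Lemma coloop_splitting s xi lam : coloop s xi lam -> lattice_cone s ->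
  exists (T : 'M[int]_g) (r : nat) (l : 'rV[int]_g) (p : 'M[int]_g),
  [/\ [/\ T \in unitmx, (r <= g)%N & conj_pid T r = p + xi *m l],
      [/\ l *m xi = 1%:M, l *m conj_pid T r = l & conj_pid T r *m xi = xi],
      [/\ p *m xi = 0, l *m p = 0 & conj_pid T r *m p = p],
      forall X, s X -> p^~ *m X = X &
      forall n (N : 'M[int]_(n, g)), (forall X, s X -> N^~ *m X = 0) -> N *m p = 0].
Proof.
move=> cl ls; have s0 := lattice_cone0 ls.
have lt := lattice_cone_add (coloop_neq0 cl) ls.
have [T [r [uT _ rg PX NP]]] := lattice_cone_projector lt.
set P := conj_pid T r in PX NP.
have PP : P *m P = P by exact: conj_pid_idem.
have Pxi : P *m xi = xi.
  apply: (@intmx_inj R); rewrite map_mxM.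
  have := PX _ (mem_cone_add _ s0) => /(congr1 (fun B => B *m lattice_vec lam)).
  by rewrite -mulmxA rank1_mul cl.1 scale1r.
(* This is [lam] made to vanish on the complement K while keeping its values on the image of [P]. *)
pose l := lam^T *m P.
have lxi : l *m xi = 1%:M.
  by rewrite /l -mulmxA Pxi [LHS]mx11_scalar -/(dual_pairing _ _) cl.1.
have lP : l *m P = l by rewrite /l -mulmxA PP.
have lX X : s X -> l^~ *m X = 0.
  move=> sX; have tX : cone_add s (rank1 xi) X by exact: cone_add_sub.
  rewrite map_mxM -mulmxA PX // -(lattice_cone_tr lt tX) -map_trmx -trmx_mul.
  by rewrite cl.2 ?trmx0.
pose p := P - xi *m l.
have pxi : p *m xi = 0 by rewrite mulmxBl Pxi -mulmxA lxi mulmx1 subrr.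
have pP : p *m P = p by rewrite mulmxBl PP -mulmxA lP.
exists T, r, l, p; split.
- by split=> //; rewrite subrK.
- by [].
- by split=> //; [rewrite mulmxBr lP mulmxA lxi mul1mx subrr|rewrite mulmxBr PP mulmxA Pxi].
- move=> X sX; rewrite map_mxB mulmxBl PX; last exact: cone_add_sub.
  by rewrite map_mxM -mulmxA lX // mulmx0 subr0.
- move=> n N NX; rewrite -pP mulmxA; apply: NP => _ [X [c [sX c0 ->]]].
  have pX : p^~ *m X = X.
    rewrite map_mxB mulmxBl PX; last exact: cone_add_sub.
    by rewrite map_mxM -mulmxA lX // mulmx0 subr0.
  rewrite mulmxDr map_mxM -mulmxA pX NX // add0r -scalemxAr /rank1 /lattice_vec.
  by rewrite mulmxA -[_ *m p^~ *m _]mulmxA -map_mxM pxi map_mx0 mulmx0 mul0mx scaler0.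
Qed.

(** Split Z^g for both cones. The matrix [k'] is [k] on the saturation, sends [xi] to [xi'], and
    maps one complement onto the other, which is possible because the ranks agree. *)
Lemma extend_equivalence s s' xi xi' lam lam' k :
    coloop s xi lam -> coloop s' xi' lam' ->
    lattice_cone s -> k \in unitmx -> s' = act_cone k s ->
  exists k', [/\ k' \in unitmx, forall X, s X -> act k' X = act k X & k' *m xi = xi'].
Proof.
move=> cl cl' ls uk s'E.
have ls' : lattice_cone s' by rewrite s'E; exact: lattice_cone_act.
have [T [r [l [p [[uT rg PE] [lxi lP Pxi] [pxi lp Pp] pX Np]]]]] := coloop_splitting cl ls.
have [T' [r' [l' [p' [[uT' rg' PE'] [lxi' lP' Pxi'] [pxi' lp' Pp'] pX' Np']]]]] :=
  coloop_splitting cl' ls'.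
set P := conj_pid T r in PE lP Pxi Pp; set P' := conj_pid T' r' in PE' lP' Pxi' Pp'.
have uvk : invmx k \in unitmx by rewrite unitmx_inv.
have kX n (N : 'M[int]_(n, g)) X : N^~ *m act k X = (N *m k)^~ *m X *m (k^~)^T.
  by rewrite /act map_mxM !mulmxA.
have transp X : s X -> X^T = X.
  by move=> sX; exact: (lattice_cone_tr ls).
have kT_inj n (B B' : 'M[R]_(n, g)) : B *m (k^~)^T = B' *m (k^~)^T -> B = B'.
  move=> /(congr1 (fun C => C *m ((invmx k)^~)^T)).
  by rewrite -!mulmxA -!trmx_mul -map_mxM mulVmx // map_mx1 trmx1 !mulmx1.
have p'kX X : s X -> (p' *m k)^~ *m X = k^~ *m X.
  move=> sX; apply: kT_inj; rewrite -kX pX' ?s'E; last by exists X.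
  by rewrite /act.
(* This and the next identities say that [k] maps the saturation for [s] into that for [s'], and its
   inverse does the converse. Each is checked on forms only. *)
have l'kp : l' *m k *m p = 0.
  apply: Np => X sX; apply: (kT_inj); rewrite mul0mx -kX.
  have s'kX : s' (act k X) by rewrite s'E; exists X.
  by rewrite -(pX' _ s'kX) mulmxA -map_mxM lp' map_mx0 mul0mx.
have p'kp : p' *m k *m p = k *m p.
  apply/eqP; rewrite -subr_eq0 -mulmxBl; apply/eqP; apply: Np => X sX.
  by rewrite map_mxB mulmxBl p'kX // subrr.
have pkp' : k *m p *m invmx k *m p' = p'.
  apply/eqP; rewrite -subr_eq0 -[X in _ - X]mul1mx -mulmxBl; apply/eqP; apply: Np'.
  rewrite s'E => _ [X sX <-]; rewrite kX mulmxBl mul1mx mulmxKV // map_mxB mulmxBl.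
  by rewrite map_mxM -mulmxA pX // subrr mul0mx.
have pvkp' : p *m invmx k *m p' = invmx k *m p'.
  by rewrite -[in RHS]pkp' !mulmxA mulVmx // mul1mx.
(* Cyclicity of the trace equates the traces of [p] and [p'], and the projectors onto the lines of
   the coloops each add 1. *)
have rr' : r = r'.
  have trp : \tr p = \tr p'.
    rewrite -[in RHS]pkp' -[k *m p *m _ *m _]mulmxA [RHS]mxtrace_mulC -mulmxA.
    by rewrite [p' *m (k *m p)]mulmxA p'kp mulmxA mulVmx // mul1mx.
  have tr1 (x : 'cV[int]_g) (m : 'rV_g) : m *m x = 1%:M -> \tr (x *m m) = 1.
    by move=> mx; rewrite mxtrace_mulC mx mxtrace1.
  have := mxtrace_conj_pid uT rg; have := mxtrace_conj_pid uT' rg'.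
  by rewrite -/P -/P' PE PE' !linearD /= !tr1 // -trp => -> [].
(* With equal ranks [H] conjugates one projector into the other, hence carries complement to
   complement. *)
pose H := T' *m invmx T.
have uH : H \in unitmx by rewrite unitmx_mul uT' unitmx_inv.
have P'H : P' *m H = H *m P.
  by rewrite /P /P' /conj_pid rr' /H !mulmxA !mulmxKV.
have PP : P *m P = P by exact: conj_pid_idem.
have PP' : P' *m P' = P' by exact: conj_pid_idem.
clearbody P P' H.
have [p3 p3E] : {p3 | p3 = 1%:M - P} by eexists.
have p33 : p3 *m p3 = p3.
  by rewrite p3E mulmxBl mul1mx mulmxBr mulmx1 PP subrr subr0.
have P3 : P *m p3 = 0.
  by rewrite p3E mulmxBr mulmx1 PP subrr.
have [p3' p3'E] : {p3' | p3' = 1%:M - P'} by eexists.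
have p3'P' : p3' *m P' = 0.
  by rewrite p3'E mulmxBl mul1mx PP' subrr.
have P'Hp3 : P' *m (H *m p3) = 0 by rewrite mulmxA P'H -mulmxA P3 mulmx0.
have p'P' : p' *m P' = p'.
  have -> : p' = P' - xi' *m l' by rewrite PE' addrK.
  by rewrite mulmxBl PP' -mulmxA lP'.
pose k' := k *m p + xi' *m l + H *m p3.
(* The inverse of [k'], assembled from the inverses of its three pieces. *)
pose k'' := invmx k *m p' + xi *m l' + invmx H *m p3'.
have k''k' : k'' *m k' = 1%:M.
  have c1 : (invmx k *m p') *m k' = p.
    rewrite /k' !mulmxDr.
    have -> : invmx k *m p' *m (k *m p) = p.
      by rewrite -mulmxA [p' *m _]mulmxA p'kp mulmxA mulVmx // mul1mx.
    have -> : invmx k *m p' *m (xi' *m l) = 0.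
      by rewrite -mulmxA [p' *m _]mulmxA pxi' mul0mx mulmx0.
    have -> : invmx k *m p' *m (H *m p3) = 0.
      by rewrite -p'P' -!mulmxA P'Hp3 !mulmx0.
    by rewrite !addr0.
  have c2 : (xi *m l') *m k' = xi *m l.
    rewrite /k' !mulmxDr.
    have -> : xi *m l' *m (k *m p) = 0 by rewrite -mulmxA [l' *m _]mulmxA l'kp mulmx0.
    have -> : xi *m l' *m (xi' *m l) = xi *m l.
      by rewrite -mulmxA [l' *m _]mulmxA lxi' mul1mx.
    have -> : xi *m l' *m (H *m p3) = 0.
      by rewrite -lP' -!mulmxA P'Hp3 !mulmx0.
    by rewrite add0r addr0.
  have c3 : (invmx H *m p3') *m k' = p3.
    rewrite /k' !mulmxDr.
    have -> : invmx H *m p3' *m (k *m p) = 0.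
      by rewrite -p'kp -Pp' -!mulmxA [p3' *m _]mulmxA p3'P' mul0mx mulmx0.
    have -> : invmx H *m p3' *m (xi' *m l) = 0.
      by rewrite -Pxi' -!mulmxA [p3' *m _]mulmxA p3'P' mul0mx mulmx0.
    have -> : invmx H *m p3' *m (H *m p3) = p3.
      by rewrite p3'E mulmxBr mulmx1 mulmxBl -[_ *m P' *m _]mulmxA P'Hp3 mulmx0 subr0 mulKmx.
    by rewrite !add0r.
  by rewrite /k'' !mulmxDl c1 c2 c3 -PE p3E addrC subrK.
have [_ uk'] := mulmx1_unit k''k'.
have lX X : s X -> l^~ *m X = 0.
  by move=> sX; rewrite -(pX _ sX) mulmxA -map_mxM lp map_mx0 mul0mx.
have k'X X : s X -> k'^~ *m X = k^~ *m X.
  move=> sX; rewrite /k' !map_mxD !map_mxM !mulmxDl -!mulmxA pX // lX // mulmx0 addr0.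
  have -> : p3^~ *m X = 0; last by rewrite mulmx0 addr0.
  by rewrite -(pX _ sX) mulmxA -map_mxM p3E mulmxBl mul1mx Pp subrr map_mx0 mul0mx.
exists k'; split=> //.
  move=> X sX; rewrite /act k'X // -!mulmxA; congr (_ *m _).
  by rewrite -[in LHS](transp _ sX) -[in RHS](transp _ sX) -!trmx_mul k'X.
rewrite /k' !mulmxDl -[k *m p *m xi]mulmxA pxi mulmx0 add0r -[xi' *m l *m xi]mulmxA lxi mulmx1.
by rewrite p3E -mulmxA mulmxBl mul1mx Pxi subrr mulmx0 addr0.
Qed.

Lemma inflates_same_orbit s s' t t' : inflates s t -> inflates s' t' ->
  lattice_cone s -> same_orbit s s' -> same_orbit t t'.
Proof.
move=> [xi [lam [cl ->]]] [xi' [lam' [cl' ->]]] ls [k uk s'E].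
have [k' [uk' k'k k'xi]] := extend_equivalence cl cl' ls uk s'E.
exists k' => //; rewrite act_cone_add act_rank1 k'xi s'E; congr cone_add.
by apply: eq_imagel => X sX; rewrite k'k.
Qed.

(** By [coloop_unique] a stabilizer of [t] stabilizes [s] and fixes the added form; by
    [extend_equivalence] a stabilizer of [s] extends to one of [t] fixing it. Fixing the last basis
    vector leaves the determinant unchanged. *)
Lemma alternating_inflation s t : inflates s t -> perfect_cone t -> coloop_free s ->
  alternating s <-> alternating t.
Proof.
move=> infl pt sf; have ps := inflates_perfect infl pt.
case: infl pt => xi [lam [cl ->]] pt.
have [m [_ ms mx]] := coloop_functional cl.
have s0 := lattice_cone0 (perfect_lattice_cone ps).
have sb := vbasisP (linear_span s); set b := vbasis _ in sb.
have tb := basis_cone_add s0 ms mx sb.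
have det_eq h : h \in unitmx -> act_cone h s = s -> act h (rank1 xi) = rank1 xi :> form ->
    basis_change_det (rcons b (rank1 xi)) (map (act h) (rcons b (rank1 xi))) =
    basis_change_det b (map (act h) b).
  move=> uh hs hx; rewrite map_rcons hx.
  rewrite (basis_change_det_rcons (a := 1) (basis_free tb)) ?mulr1 ?size_map //.
    move=> X Xb; rewrite (span_basis sb).
    by apply: basis_mem Xb; rewrite -{1}hs; exact: basis_act.
  by rewrite scale1r subrr mem0v.
split=> alt.
  apply: (det_alternating pt tb) => h uh ht.
  have ht' := ht; rewrite act_cone_add act_rank1 in ht'.
  have [hs hx] := coloop_unique cl (coloop_act uh cl) pt sf (esym ht').
  rewrite det_eq ?act_rank1 //; exact: (alternating_det alt).
apply: (det_alternating ps sb) => h uh hs.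
have [k [uk kh kx]] := extend_equivalence cl cl (perfect_lattice_cone ps) uh (esym hs).
have ks : act_cone k s = s by rewrite -[RHS]hs; apply: eq_imagel => X sX; rewrite kh.
rewrite -(map_act_eq kh sb) -det_eq ?act_rank1 ?kx //.
by apply: (alternating_det alt) => //; rewrite act_cone_add ks act_rank1 kx.
Qed.

Lemma inflates_unique s s1 t : inflates s t -> inflates s1 t -> perfect_cone t ->
  coloop_free s -> s1 = s.
Proof.
move=> [xi [lam [cl ->]]] [xi1 [lam1 [cl1 tE]]] pt sf.
by have [] := coloop_unique cl cl1 pt sf tE.
Qed.

End Equivalence.

(** * Existence of perfect inflations *)

Section InflationExists.
Context {R : realType} {g : nat}.
Local Notation form := 'M[R]_g.
Local Notation "A ^~" := (map_mx intr A : 'M[R]_(_, _)) (at level 2, format "A ^~").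
Implicit Types (Q X Y : form) (h k : 'M[int]_g) (s t : set form).
Implicit Types (xi zeta lam : 'cV[int]_g) (M : set 'cV[int]_g).

Lemma cone_dim_zero : cone_dim [set 0 : form] = 0%N.
Proof.
rewrite /cone_dim; have -> : linear_span [set 0 : form] = 0%VS; last exact: dimv0.
by apply/eqP; rewrite -subv0; apply: linear_span_sub => X ->; exact: mem0v.
Qed.

(** This treats the zero cone together with the cones of minimal vectors. For the zero cone [P] is
    0, so no nonzero vector is constrained and the value 1 for [m] is arbitrary. *)
Lemma perfect_cone_sublattice_minimum s (P : 'M[int]_g) : perfect_cone s ->
    (forall X, s X -> P^~ *m X = X) -> (s = [set 0] -> P = 0) ->
  exists Q M (m : R), [/\ positive_definite Q, 0 < m, s = rank1_hull M,
    forall zeta, zeta != 0 -> P *m zeta = zeta ->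
      m <= form_eval Q (lattice_vec zeta) /\
      (form_eval Q (lattice_vec zeta) = m -> M zeta) &
    forall zeta, M zeta ->
      [/\ zeta != 0, P *m zeta = zeta & form_eval Q (lattice_vec zeta) = m]].
Proof.
move=> ps PX P0.
have hull0 : rank1_hull set0 = [set 0 : form].
  rewrite /rank1_hull image_set0; apply/seteqP; split=> [|_ ->]; last exact: conic_hull0.
  by apply: conic_hull_min => // x y -> ->; rewrite addr0.
have zero_case : s = [set 0] -> exists Q M (m : R), [/\ positive_definite Q, 0 < m,
    s = rank1_hull M, forall zeta, zeta != 0 -> P *m zeta = zeta ->
      m <= form_eval Q (lattice_vec zeta) /\
      (form_eval Q (lattice_vec zeta) = m -> M zeta) &
    forall zeta, M zeta ->
      [/\ zeta != 0, P *m zeta = zeta & form_eval Q (lattice_vec zeta) = m]].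
  move=> s0; exists 1%:M, set0, 1; split=> //; rewrite ?hull0 //.
    exact: positive_definite1.
  by move=> zeta z0; rewrite P0 // mul0mx => z; rewrite -z eqxx in z0.
case: (ps) => [/zero_case //|[Q pQ sQ]].
have [M0|/set0P[zeta0 [z0 min0]]] := eqVneq (minimal_vectors Q) set0.
  by apply: zero_case; rewrite sQ /sigma M0; exact: hull0.
exists Q, (minimal_vectors Q), (form_eval Q (lattice_vec zeta0)); split=> //.
- by apply: pQ.2; exact: lattice_vec_neq0.
- move=> zeta zn0 _; split; first exact: min0.
  by move=> zE; split=> // zeta'; rewrite zE; exact: min0.
- move=> zeta [zn0 minz]; split=> //; last first.
    by apply/eqP; rewrite eq_le minz // min0.
  apply: (@intmx_inj R); rewrite map_mxM.
  have Pz : (P^~ - 1%:M) *m rank1 zeta = 0.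
    rewrite mulmxBl mul1mx PX ?subrr // sQ; apply: conic_hull_sub; by exists zeta.
  have := mul_rank1_eq0 zn0 Pz; rewrite mulmxBl mul1mx => /eqP.
  by rewrite subr_eq0 => /eqP.
Qed.

(* If s is generated by the minimal vectors of Q, of value m, then the minimal
   vectors of Q(P x) + m y_r^2 + 2 m (y_(r+1)^2 + ... + y_(g-1)^2), y = T^-1 x, are
   those of Q together with the column of T of index r, up to sign. *)
Lemma perfect_cone_inflates s : perfect_cone s -> (cone_dim s < g)%N ->
  exists2 t, perfect_cone t & inflates s t.
Proof.
move=> ps ds; have [T [r [uT rd rg PX _]]] := lattice_cone_projector (perfect_lattice_cone ps).
set P := conj_pid T r in PX.
have P0 : s = [set 0] -> P = 0.
  move=> s0; have r0 : r = 0%N by apply/eqP; rewrite -leqn0; move: rd; rewrite s0 cone_dim_zero.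
  by rewrite /P /conj_pid r0 pid_mx_0 mulmx0 mul0mx.
have [Q [M [m [pQ m0 sM Qmin Mval]]]] := perfect_cone_sublattice_minimum ps PX P0.
(* The first column of [T] outside the saturation; it exists because r <= dim s < g. *)
pose i0 : 'I_g := Ordinal (leq_ltn_trans rd ds).
pose lam i : 'cV[int]_g := (row i (invmx T))^T.
pose xi : 'cV[int]_g := col i0 T.
have pairE i zeta : dual_pairing (lam i) zeta = (invmx T *m zeta) i 0.
  by rewrite /dual_pairing trmxK -row_mul mxE.
have lamxi i : dual_pairing (lam i) xi = (i == i0)%:R.
  by rewrite pairE /xi colE mulmxA mulVmx // mul1mx mxE eqxx andbT.
have lamP (i : 'I_g) zeta : (r <= i)%N -> dual_pairing (lam i) (P *m zeta) = 0.
  move=> ri; rewrite pairE /P /conj_pid !mulmxA mulVmx // mul1mx -mulmxA pid_mulmxE.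
  by rewrite ltnNge ri mulr0n.
have lam0P zeta : (forall i : 'I_g, (r <= i)%N -> dual_pairing (lam i) zeta = 0) ->
    P *m zeta = zeta.
  move=> l0; rewrite -[RHS](mulKVmx uT) /P /conj_pid -!mulmxA; congr (_ *m _).
  apply/matrixP => i j; rewrite ord1 pid_mulmxE -pairE; case: ltnP => // ri.
  by rewrite l0.
have Pxi : P *m xi = 0.
  rewrite /P /conj_pid /xi colE -!mulmxA (mulKmx uT).
  rewrite (_ : pid_mx r *m _ = 0) ?mulmx0 //.
  apply/matrixP => i j; rewrite pid_mulmxE !mxE.
  by have [->|] := eqVneq i i0; rewrite /= ?ltnn ?mulr0n ?mul0rn.
(* The weights are 0 below [r], 1 at [r] and 2 above it. The weight 2 keeps vectors with a nonzero
   later coordinate strictly above the minimum [m]. *)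
pose c (i : 'I_g) : R := ((r <= i)%N)%:R + ((r < i)%N)%:R.
have c_ge0 i : 0 <= c i by rewrite addr_ge0 ?ler0n.
have c_ge1 (i : 'I_g) : (r <= i)%N -> 1 <= c i by move=> ri; rewrite /c ri lerDl ler0n.
have ci0 : c i0 = 1 by rewrite /c leqnn ltnn addr0.
have cr (i : 'I_g) : (i < r)%N -> c i = 0 by move=> ir; rewrite /c leqNgt ir ltnNge (ltnW ir) addr0.
pose Q' : form := P^~^T *m Q *m P^~ + m *: \sum_i c i *: rank1 (lam i).
have Q'E x : form_eval Q' x = form_eval Q (P^~ *m x) +
    m * \sum_i c i * form_eval (rank1 (lam i)) x.
  rewrite /Q' /form_eval mulmxDr mulmxDl mxE trmx_mul !mulmxA; congr (_ + _).
  rewrite -scalemxAr -scalemxAl mxE; congr (_ * _).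
  rewrite mulmx_sumr mulmx_suml summxE; apply: eq_bigr => i _.
  by rewrite -scalemxAr -scalemxAl mxE.
have term_ge0 x i : 0 <= c i * form_eval (rank1 (lam i)) x.
  by rewrite mulr_ge0 // form_eval_rank1 sqr_ge0.
have Q'Z zeta : form_eval Q' (lattice_vec zeta) = form_eval Q (lattice_vec (P *m zeta)) +
    m * \sum_i c i * (dual_pairing (lam i) zeta)%:~R ^+ 2.
  have -> : lattice_vec (P *m zeta) = P^~ *m lattice_vec zeta :> 'cV[R]_g by exact: map_mxM.
  rewrite Q'E; congr (_ + _ * _).
  by apply: eq_bigr => i _; rewrite dual_pairingC -form_eval_rank1_lattice.
have Q'P zeta : P *m zeta = zeta ->
    form_eval Q' (lattice_vec zeta) = form_eval Q (lattice_vec zeta).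
  move=> Pz; rewrite Q'Z Pz big1 ?mulr0 ?addr0 // => i _.
  have [ir|ri] := ltnP i r; first by rewrite cr // mul0r.
  by rewrite -Pz lamP // expr0n mulr0.
have pQ' : positive_definite Q'.
  split=> [|x x0].
    rewrite /Q' linearD /= !trmx_mul trmxK pQ.1 mulmxA linearZ /= linear_sum /=.
    congr (_ + _ *: _); apply: eq_bigr => i _; by rewrite linearZ /= rank1_tr.
  have Qx := form_eval_ge0 (P^~ *m x) pQ.
  have S0 : 0 <= \sum_i c i * form_eval (rank1 (lam i)) x by apply: sumr_ge0.
  rewrite Q'E; have [Px0|Px0] := eqVneq (P^~ *m x) 0; last first.
    by rewrite ltr_pwDl ?pQ.2 // mulr_ge0 // ltW.
  rewrite Px0 form_eval0 add0r mulr_gt0 // lt_neqAle S0 andbT.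
  apply/eqP => /esym/eqP; rewrite psumr_eq0 // => /allP all0.
  have ev (i : 'I_g) : (r <= i)%N -> ((invmx T)^~ *m x) i 0 = 0.
    move=> ri; have := all0 i (mem_index_enum _) => /=.
    rewrite mulf_eq0 (gt_eqF (lt_le_trans ltr01 (c_ge1 i ri))) /= form_eval_rank1.
    rewrite sqrf_eq0 /bilin mulmx1 /lattice_vec map_trmx trmxK map_row -row_mul mxE.
    by move/eqP.
  have Px : P^~ *m x = x.
    rewrite -[RHS]mul1mx -(map_mx1 intr) -(mulmxV uT) /P /conj_pid !map_mxM -!mulmxA.
    congr (_ *m _); rewrite map_pid_mx.
    apply/matrixP => i j; rewrite ord1 pid_mulmxE; case: ltnP => // ri.
    by rewrite ev.
  by move: x0; rewrite -Px Px0 eqxx.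
have exnz zeta : P *m zeta != zeta ->
    exists2 i : 'I_g, (r <= i)%N & dual_pairing (lam i) zeta != 0.
  move=> Pz; apply: contrapT => ni; move/eqP: Pz; apply; apply: lam0P => i ri.
  by apply: contrapT => /eqP ?; apply: ni; exists i.
have sq_ge1 (n : int) : n != 0 -> 1 <= (n%:~R : R) ^+ 2.
  move=> n0; rewrite -rmorphXn /= -[1]/(1%:~R) ler_int.
  by have := sqr_ge0 n; rewrite le_eqVlt eq_sym sqrf_eq0 (negPf n0).
have sumD zeta i : \sum_j c j * (dual_pairing (lam j) zeta)%:~R ^+ 2 =
    c i * (dual_pairing (lam i) zeta)%:~R ^+ 2 +
    \sum_(j | j != i) c j * (dual_pairing (lam j) zeta)%:~R ^+ 2.
  by rewrite (bigD1 i).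
have rest_ge0 zeta i :
    0 <= \sum_(j | j != i) c j * (dual_pairing (lam j) zeta)%:~R ^+ 2.
  by apply: sumr_ge0 => j _; rewrite mulr_ge0 ?sqr_ge0.
have Q'min zeta : zeta != 0 -> m <= form_eval Q' (lattice_vec zeta).
  move=> z0; have [Pz|/exnz[i ri li]] := eqVneq (P *m zeta) zeta.
    by rewrite Q'P //; have [] := Qmin _ z0 Pz.
  rewrite Q'Z (sumD _ i); have := form_eval_ge0 (lattice_vec (P *m zeta)) pQ.
  have := rest_ge0 zeta i; have := sq_ge1 _ li; have := c_ge1 i ri.
  set a := c i; set d := _ ^+ 2; set e := \sum_(j | _) _; set q := form_eval Q _.
  move=> a1 d1 e0 q0.
  have ad : 1 <= a * d by rewrite mulr_ege1.
  have : m * 1 <= m * (a * d + e) by rewrite ler_pM2l //; lra.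
  by rewrite mulr1; lra.
have xi0 : xi != 0.
  apply/eqP => x0; have := lamxi i0; rewrite x0 eqxx /dual_pairing mulmx0 mxE.
  by move/eqP; rewrite eq_sym oner_eq0.
have Q'xi : form_eval Q' (lattice_vec xi) = m.
  rewrite Q'Z Pxi /lattice_vec map_mx0 form_eval0 add0r (bigD1 i0) //= big1.
    by rewrite lamxi eqxx ci0 mul1r expr1n addr0 mulr1.
  by move=> i ii0; rewrite lamxi (negPf ii0) expr0n mulr0.
have Q'eq zeta : zeta != 0 -> form_eval Q' (lattice_vec zeta) = m ->
    M zeta \/ rank1 zeta = rank1 xi :> form.
  move=> z0; have [Pz|/exnz[i ri li]] := eqVneq (P *m zeta) zeta.
    by rewrite Q'P // => Qz; left; apply: (Qmin _ z0 Pz).2.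
  rewrite Q'Z (sumD _ i); have := form_eval_ge0 (lattice_vec (P *m zeta)) pQ.
  have := rest_ge0 zeta i; have := sq_ge1 _ li; have := c_ge1 i ri.
  set a := c i; set d := _ ^+ 2; set e := \sum_(j | _) _; set q := form_eval Q _.
  move=> a1 d1 e0 q0 E; right.
  have ad : 1 <= a * d by rewrite mulr_ege1.
  have : m * 1 <= m * (a * d + e) by rewrite ler_pM2l //; lra.
  (* As q and e are nonnegative and a d >= 1, equality forces q = e = 0 and a d = 1. So the weight
     is 1, the index is [r], and [zeta] is [xi] up to sign. *)
  rewrite mulr1 => le1; have q_0 : q = 0 by lra.
  have : m * (a * d + e) = m * 1 by rewrite mulr1; lra.
  move/(mulfI (lt0r_neq0 m0)) => ade.
  have ad1 : a * d = 1 by lra.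
  have e_0 : e = 0 by lra.
  have a_1 : a = 1 by nra.
  have d_1 : d = 1 by rewrite a_1 mul1r in ad1.
  have ii0 : i = i0.
    apply: val_inj => /=; apply/eqP; rewrite eqn_leq ri andbT leqNgt; apply/negP => ltri.
    by move: a_1; rewrite /a /c ri ltri => /eqP; rewrite -subr_eq0 addrK oner_eq0.
  have Pz0 : P *m zeta = 0.
    by apply/eqP/negPn/negP => /(lattice_vec_neq0 (R := R))/pQ.2; rewrite -/q q_0 ltxx.
  have rest0 (j : 'I_g) : (r <= j)%N -> j != i0 -> dual_pairing (lam j) zeta = 0.
    move=> rj ji; move: e_0; rewrite /e ii0 => /eqP; rewrite psumr_eq0; last first.
      by move=> k _; rewrite mulr_ge0 ?sqr_ge0.
    move/allP/(_ j (mem_index_enum _)); rewrite ji /= mulf_eq0 sqrf_eq0 intr_eq0.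
    by rewrite (gt_eqF (lt_le_trans ltr01 (c_ge1 j rj))) /= => /eqP.
  pose n := dual_pairing (lam i0) zeta.
  have pairB l x y : dual_pairing l (x - n *: y) = dual_pairing l x - n * dual_pairing l y.
    by rewrite /dual_pairing mulmxBr -scalemxAr !mxE.
  have zE : zeta = n *: xi.
    apply/eqP; rewrite -subr_eq0 -(lam0P (zeta - n *: xi)); last first.
      move=> j rj; rewrite pairB lamxi; have [->|ji] := eqVneq j i0.
        by rewrite mulr1 subrr.
      by rewrite rest0 // mulr0 subr0.
    by rewrite mulmxBr Pz0 -scalemxAr Pxi scaler0 subr0.
  have nn : (n%:~R : R) * n%:~R = 1 by rewrite -expr2 /n -ii0; exact: d_1.
  rewrite zE /rank1 /lattice_vec map_mxZ linearZ /= -scalemxAl -scalemxAr scalerA.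
  by rewrite nn scale1r.
have cl : coloop s xi (lam i0).
  split=> [|X sX]; first by rewrite lamxi eqxx.
  have XT := lattice_cone_tr (perfect_lattice_cone ps) sX.
  rewrite -XT -[lattice_vec _]trmxK -trmx_mul -(PX _ sX) mulmxA /lattice_vec map_trmx -map_mxM.
  have -> : (lam i0)^T *m P = 0.
    rewrite trmxK /P /conj_pid !mulmxA -row_mul mulVmx // -row_mul mul1mx -row_mul.
    apply/matrixP => a b; rewrite mxE mxE (bigD1 i0) //= big1 => [|k ki].
      by rewrite !mxE ltnn andbF mul0r addr0.
    by rewrite !mxE val_eqE eq_sym (negPf ki) mul0r.
  by rewrite map_mx0 mul0mx trmx0.
exists (sigma Q'); first by right; exists Q'.
exists xi, (lam i0); split=> //.
rewrite sM -rank1_hull_add; congr conic_hull.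
apply/seteqP; split.
  move=> _ [zeta [z0 minz] <-]; rewrite -/(rank1 zeta).
  have : form_eval Q' (lattice_vec zeta) = m.
    by apply/eqP; rewrite eq_le Q'min // andbT -Q'xi minz.
  by case/(Q'eq _ z0) => [Mz|->]; [exists zeta => //; left|exists xi => //; right].
move=> _ [zeta [Mz|->] <-].
  have [z0 Pz Qz] := Mval _ Mz.
  by exists zeta => //; split=> // zeta' z'0; rewrite Q'P // Qz; exact: Q'min.
by exists xi => //; split=> // zeta' z0; rewrite Q'xi; exact: Q'min.
Qed.

End InflationExists.

(** * The differential *)

Section Differential.
Context {R : realType} {g : nat} (D : perfect_complex_data R g).
Implicit Types (h k : 'M[int]_g) (s t r : set 'M[R]_g).

(** Two presentations of a cone agree in degree by dimension and in representative by uniqueness.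
    They differ by a stabilizer, which preserves the orientation of an alternating cone. *)
Lemma cone_orientation_rep n s h : reps D n s -> h \in unitmx ->
  cone_orientation D (act_cone h s) = act_orientation h (rep_orientation D s).
Proof.
move=> Ds uh; rewrite /cone_orientation; set S := [set _ | _].
have [n' [s' [h' [Ds' uh' hs ->]]]] : S (xget set0 S).
  by apply: (xgetPex set0); exists (act_orientation h (rep_orientation D s)), n, s, h.
have [_ dn] := reps_sub Ds; have [_ dn'] := reps_sub Ds'.
have nn' : n = n'.
  apply: (addIr 1); rewrite -dn -dn' -(cone_dim_act s uh) hs cone_dim_act //.
rewrite -{}nn' in Ds' dn'.
have ss' : s = s'.
  apply: (reps_uniq Ds Ds'); exists (invmx h' *m h).
    by rewrite unitmx_mul unitmx_inv uh'.
  by rewrite -act_cone_comp hs act_coneK.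
rewrite -{s'}ss' in Ds' hs dn' *; pose j := invmx h' *m h.
have uj : j \in unitmx by rewrite unitmx_mul unitmx_inv uh'.
have js : act_cone j s = s by rewrite -act_cone_comp hs act_coneK.
have [[_ alt] _] := reps_sub Ds.
have := alt j uj js _ (rep_orientationP Ds) => {1}<-.
by rewrite act_orientation_comp /j mulmxA mulmxV // mul1mx.
Qed.

Lemma alternating_rep s : alternating s ->
  exists n u h, [/\ reps D n u, h \in unitmx & s = act_cone h u].
Proof.
move=> alt; have [|u Du [h uh ->]] := @reps_exist _ _ D ((cone_dim s)%:Z - 1) s.
  by split=> //; rewrite subrK.
by exists ((cone_dim s)%:Z - 1), u, h.
Qed.

Lemma cone_orientation_is s : alternating s ->
  orientation (linear_span s) (cone_orientation D s).
Proof.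
move=> /alternating_rep[n [u [h [Du uh ->]]]]; rewrite (cone_orientation_rep Du uh).
by apply: orientation_act => //; exact: rep_orientationP Du.
Qed.

Lemma cone_orientation_act s h : alternating s -> h \in unitmx ->
  cone_orientation D (act_cone h s) = act_orientation h (cone_orientation D s).
Proof.
move=> /alternating_rep[n [u [k [Du uk ->]]]] uh.
rewrite act_cone_comp !(cone_orientation_rep Du) ?unitmx_mul ?uh //.
by rewrite act_orientation_comp.
Qed.

Lemma eta_act r s h : alternating r -> alternating s -> h \in unitmx ->
  Defs.eta D (act_cone h r) (act_cone h s) = Defs.eta D r s.
Proof.
move=> ar as_ uh; rewrite /Defs.eta !cone_orientation_act // -induced_orientation_act //.
congr (if _ then _ else _); apply/asboolP/asboolP => [E|-> //].
rewrite -(act_orientation1 (cone_orientation D r)) -[RHS]act_orientation1 -(mulVmx uh).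
by rewrite -!act_orientation_comp E.
Qed.

Lemma eta_sq r s : Defs.eta D r s * Defs.eta D r s = 1.
Proof. by rewrite /Defs.eta; case: ifP => _; rewrite ?mulrNN mulr1. Qed.

Lemma delta_same_orbit t t' s : same_orbit t t' -> delta D t s = delta D t' s.
Proof.
move=> tt'; rewrite /delta; congr (\sum_(r \in _) _).
apply/seteqP; split=> r [rs tr]; split=> //.
  exact: same_orbit_trans (same_orbit_sym tt') tr.
exact: same_orbit_trans tt' tr.
Qed.

Lemma delta_act t s h : alternating t -> alternating s -> h \in unitmx ->
  delta D t (act_cone h s) = delta D t s.
Proof.
move=> at_ as_ uh; rewrite /delta.
have inj : injective (act_cone h : set 'M[R]_g -> _) := can_inj (fun u => act_coneK u uh).
rewrite (reindex_fsbig (act_cone h) [set r | facet s r /\ same_orbit t r]).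
  apply: eq_fsbigr => r; rewrite inE => -[_ tr].
  by rewrite eta_act //; exact: alternating_same_orbit tr at_.
have orb (u : set 'M[R]_g) : same_orbit u (act_cone h u) by exists h.
have uv : invmx h \in unitmx by rewrite unitmx_inv.
split=> [r [sr tr]|r r' _ _ /inj //|r [sr tr]].
  by split; [exact: facet_act|exact: same_orbit_trans tr (orb r)].
exists (act_cone (invmx h) r); last exact: act_coneVK.
split; first by have := facet_act uv sr; rewrite act_coneK.
by apply: same_orbit_trans tr _; exists (invmx h).
Qed.

Lemma inflates_facet s t : inflates s t -> s 0 -> facet t s.
Proof.
move=> [xi [lam [cl ->]]] s0; have [m [_ ms mx]] := coloop_functional cl.
exact: facet_cone_add_base s0 ms mx.
Qed.

Lemma coloop_free_facet s t r : inflates s t -> s 0 -> facet t r -> coloop_free r -> r = s.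
Proof.
move=> [xi [lam [cl ->]]] s0; have [m [_ ms mx]] := coloop_functional cl.
move=> /(facet_cone_addP s0 ms mx)[//|[F Fs ->]] []; exists F, xi, lam; split=> //.
by split=> [|X /(face_sub Fs.1)]; [exact: cl.1|exact: cl.2].
Qed.

(** Only one facet contributes, so this incidence number is a sign and can be inverted. *)
Lemma delta_inflation s s' t : inflates s' t -> s' 0 -> coloop_free s' -> same_orbit s s' ->
  delta D s t = Defs.eta D s' t.
Proof.
move=> infl s'0 sf ss'; rewrite /delta.
suff -> : [set r | facet t r /\ same_orbit s r] = [set s'] by rewrite fsbig_set1.
apply/seteqP; split=> [r [tr sr]|_ ->]; last by split=> //; exact: inflates_facet.
apply: (coloop_free_facet infl s'0 tr).
exact: coloop_free_same_orbit (same_orbit_trans (same_orbit_sym ss') sr) sf.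
Qed.

Lemma delta_neq0 t s : delta D t s != 0 -> exists2 r, facet s r & same_orbit t r.
Proof.
move=> d0; apply: contrapT => nr; move/eqP: d0; apply.
by apply: fsbig1 => r [sr tr]; case: nr; exists r.
Qed.

Lemma eta_anticommute F s xi lam :
    coloop s xi lam -> alternating s -> facet s F -> alternating F ->
    alternating (cone_add F (rank1 xi)) -> alternating (cone_add s (rank1 xi)) ->
  Defs.eta D F s * Defs.eta D s (cone_add s (rank1 xi)) =
  - (Defs.eta D F (cone_add F (rank1 xi)) *
     Defs.eta D (cone_add F (rank1 xi)) (cone_add s (rank1 xi))).
Proof.
move=> cl as_ sF aF aG aT; have [m [_ ms mx]] := coloop_functional cl.
have xi0 := coloop_neq0 cl.
have [M [M0 sM]] := perfect_lattice_cone as_.1.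
have [M' [M'0 FM]] := perfect_lattice_cone aF.1.
have s0 : s 0 by rewrite sM; exact: conic_hull0.
have hull0 (A : set 'cV[int]_g) : (forall zeta, A zeta -> zeta != 0) ->
    forall zeta, (A `|` [set xi]) zeta -> zeta != 0.
  by move=> A0 zeta [/A0|->].
(* A generator of [s] off [F] spans a ray of both [s] and its inflation, so one [v] computes both
   induced orientations. *)
have [v [zeta Mz vE] nFv] : exists2 v, (rank1 @` M) v & ~ F v.
  by apply: facet_conic_hull_notin; rewrite -/(rank1_hull M) -sM.
have sv : ray_generator s v.
  by rewrite -vE sM; exact: ray_generator_rank1 (M0 _ Mz) Mz.
have tv : ray_generator (cone_add s (rank1 xi)) v.
  rewrite -vE sM -rank1_hull_add; apply: ray_generator_rank1; first exact: M0.
  by left.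
have tx : ray_generator (cone_add s (rank1 xi)) (rank1 xi).
  by rewrite sM -rank1_hull_add; apply: ray_generator_rank1 => //; right.
have Gx : ray_generator (cone_add F (rank1 xi)) (rank1 xi).
  by rewrite FM -rank1_hull_add; apply: ray_generator_rank1 => //; right.
have := facet_orientations_anticommute s0 ms mx sF sv nFv tv Gx tx
  (cone_orientation_is aF) (cone_orientation_is as_) (cone_orientation_is aG)
  (cone_orientation_is aT).
rewrite /Defs.eta; do 4 case: asboolP => ?; rewrite ?mulr1 ?mulrN1 ?mulN1r ?opprK //; tauto.
Qed.

(** Adding the coloop of [t] matches the facets of [s] in the orbit of [F] with the facets of [t] in
    the orbit of [G]; [s] itself is not among the latter, having no coloop. One element of GL_g(Z)
    moves [F] and [G] together, so the incidence sign of [F] in [G] is constant along the sum. *)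
Lemma delta_anticommute F G s t : alternating F -> alternating G ->
    alternating s -> alternating t -> coloop_free F -> coloop_free s ->
    inflates F G -> inflates s t ->
  delta D F s * Defs.eta D s t = - (Defs.eta D F G * delta D G t).
Proof.
move=> aF aG as_ at_ Ff sf FG st.
case: (st) => xi [lam [cl tE]]; have [m [_ ms mx]] := coloop_functional cl.
have s0 := lattice_cone0 (perfect_lattice_cone as_.1).
pose x : 'M[R]_g := rank1 xi.
have infl F' : facet s F' -> inflates F' (cone_add F' x).
  move=> sF'; exists xi, lam; split=> //; split=> [|X /(face_sub sF'.1)]; first exact: cl.1.
  exact: cl.2.
have orbG F' : facet s F' -> same_orbit F F' ->
    exists k, [/\ k \in unitmx, F' = act_cone k F & cone_add F' x = act_cone k G].
  move=> sF' FF'.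
  have [k uk GE] := inflates_same_orbit FG (infl _ sF') (perfect_lattice_cone aF.1) FF'.
  exists k; split=> //; apply: (inflates_unique (t := cone_add F' x)).
  - by rewrite GE; exact: inflates_act.
  - exact: infl.
  - by rewrite GE; exact: perfect_cone_act aG.1.
  - exact: coloop_free_act.
have reidx : delta D G t =
    \sum_(F' \in [set r | facet s r /\ same_orbit F r]) Defs.eta D (cone_add F' x) t.
  rewrite /delta; apply: reindex_fsbig; split.
  - move=> F' [sF' FF']; split; first by rewrite tE; exact: facet_cone_add_facet s0 ms mx _ sF'.
    by have [k [uk _ ->]] := orbG _ sF' FF'; exists k.
  - move=> F1 F2; rewrite !inE => -[sF1 _] [sF2 _].
    exact: (cone_add_inj ms mx (face_sub sF1.1) (face_sub sF2.1)).
  - move=> G' [tG' [k uk GE]].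
    have iG' : inflates (act_cone k F) G' by rewrite GE; exact: inflates_act.
    move: tG'; rewrite tE => /(facet_cone_addP s0 ms mx)[G's|[F' sF' G'E]].
      by case: sf; rewrite -G's; exists (act_cone k F).
    exists F' => //; split=> //; exists k => //.
    apply: (inflates_unique (t := G')) => //.
    + by rewrite G'E; exact: infl.
    + by rewrite GE; exact: perfect_cone_act aG.1.
    + exact: coloop_free_act.
rewrite reidx mulr_fsumr -mulN1r mulr_fsumr mulr_fsuml.
apply: eq_fsbigr => F'; rewrite inE => -[sF' FF'].
have [k [uk F'E G'E]] := orbG _ sF' FF'.
have aF' : alternating F' by rewrite F'E; exact: alternating_act.
have aG' : alternating (cone_add F' x) by rewrite G'E; exact: alternating_act.
rewrite -(eta_act aF aG uk) -F'E -G'E mulN1r tE.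
apply: (eta_anticommute cl as_ sF' aF' aG'); by rewrite -tE.
Qed.

Lemma finite_perfect_facets s : perfect_cone s -> finite_set [set r | facet s r].
Proof.
move=> /perfect_cone_hull[M [finM _ ->]]; apply: finite_facets.
exact: finite_image.
Qed.

(** A representative with nonzero incidence is determined by any facet of [s] in its orbit. *)
Lemma finite_delta_support n s : perfect_cone s ->
  finite_set [set t : reps D n | delta D (val t) s != 0].
Proof.
move=> ps; set S := [set _ | _].
have [->|/set0P[t0 _]] := eqVneq S set0; first exact: finite_set0.
pose f r : reps D n := xget t0 [set t | same_orbit (val t) r].
apply: (@sub_finite_set _ _ (f @` [set r | facet s r])); last first.
  by apply: finite_image; exact: finite_perfect_facets.
move=> t /delta_neq0[r sr tr]; exists r => //.
have fr : same_orbit (val (f r)) r.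
  by apply: (xgetPex t0 (P := [set t | same_orbit (val t) r])); exists t.
 apply: val_inj; apply: (reps_uniq (set_valP _) (set_valP _)).
exact: same_orbit_trans fr (same_orbit_sym tr).
Qed.

Lemma rep_alternating n (s : reps D n) : alternating (val s).
Proof. by have [] := reps_sub (set_valP s). Qed.

Lemma coeff_delta_sum n s (t : reps D n) : perfect_cone s ->
  coeff t (\sum_(u \in [set: reps D n]) delta D (val u) s *: chain_basis u) = delta D (val t) s.
Proof.
move=> ps; pose S := fset_set [set u : reps D n | delta D (val u) s != 0].
have memS u : (u \in S) = (delta D (val u) s != 0).
  have finS := finite_delta_support n ps.
  by apply/idP/idP; rewrite in_fset_set // inE.
rewrite (fsbigE (enum_fset S)) ?fset_uniq //; last first.
  by move=> u _; rewrite memS negbK => /eqP ->; rewrite scale0r.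
rewrite raddf_sum /=.
under eq_bigr => u _ do rewrite [coeff t _]coeff_fgscale coeffU mul1r.
have [tS|tS] := boolP (t \in S).
  rewrite (big_rem t) //= in_setT eqxx mulr1 big1_seq ?addr0 // => u.
  rewrite mem_rem_uniq ?fset_uniq // inE => /and3P[_ ut _].
  by rewrite (negPf ut) mulr0.
rewrite big1_seq => [|u /andP[_ uS]].
  by move: tS; rewrite memS negbK => /eqP.
by have [ut|_] := eqVneq u t; [rewrite -ut uS in tS|rewrite mulr0].
Qed.

Lemma coeff_boundary m n (x : perfect_chain D m) (t : reps D n) :
  coeff t (boundary n x) = \sum_(s <- dom x) coeff s x * delta D (val t) (val s).
Proof.
rewrite -{1}(Freeg_dom x) /boundary fglift_Freeg /prelift big_map raddf_sum.
apply: eq_bigr => s _; rewrite [LHS]coeff_fgscale coeff_delta_sum //.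
exact: (rep_alternating s).1.
Qed.

Lemma coeff_boundaryU m n (a : rat) (s : reps D m) (t : reps D n) :
  coeff t (boundary n (<< a *g s >> : perfect_chain D m)) = a * delta D (val t) (val s).
Proof.
rewrite /boundary liftU [LHS]coeff_fgscale coeff_delta_sum //.
exact: (rep_alternating s).1.
Qed.

(** The representative chosen for the orbit of the inflation need not contain [s] itself, hence the
    translate [s']. *)
Lemma rep_inflation n (s : reps D n) : coloop_free (val s) -> n <= g%:Z - 2 ->
  exists (t : reps D (n + 1)) s', same_orbit (val s) s' /\ inflates s' (val t).
Proof.
move=> sf ng; have [as_ ds] := reps_sub (set_valP s).
(* Degree [n] means dimension n + 1, so the degree bound is exactly what an inflation requires. *)
have dg : (cone_dim (val s) < g)%N by rewrite -ltz_nat ds; lia.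
have [t pt st] := perfect_cone_inflates as_.1 dg.
have at_ : alternating t by apply/(alternating_inflation st).
have dt : alternating_cones (n + 1) t.
  split=> //; have [_] := inflates_facet st (lattice_cone0 (perfect_lattice_cone as_.1)).
  by move=> ->; rewrite -ds -addn1 PoszD.
have [u Du [h uh ut]] := @reps_exist _ _ D _ _ dt.
have uv : invmx h \in unitmx by rewrite unitmx_inv.
exists (exist _ u (mem_set Du)), (act_cone (invmx h) (val s)); split.
  by exists (invmx h).
have := inflates_act uv st; by rewrite ut act_coneK.
Qed.

Lemma rep_coloop n (t : reps D n) : ~ coloop_free (val t) ->
  exists (s : reps D (n - 1)) s', [/\ alternating s', coloop_free s',
    same_orbit (val s) s' & inflates s' (val t)].
Proof.
move=> /contrapT[s' st]; have at_ := rep_alternating t.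
have sf := two_coloops_not_alternating st at_.
have as_ : alternating s' by apply/(alternating_inflation st at_.1 sf).
have ds : alternating_cones (n - 1) s'.
  split=> //; have [_] := inflates_facet st (lattice_cone0 (perfect_lattice_cone as_.1)).
  by have [_ dt] := reps_sub (set_valP t); move=> E; move: dt; rewrite E; lia.
have [u Du us] := @reps_exist _ _ D _ _ ds.
by exists (exist _ u (mem_set Du)), s'.
Qed.

Lemma inflations_same_rep n (t u : reps D n) s s' : inflates s (val t) ->
  inflates s' (val u) -> lattice_cone s -> same_orbit s s' -> t = u.
Proof.
move=> st su ls ss'; apply: val_inj; apply: (reps_uniq (set_valP _) (set_valP _)).
exact: inflates_same_orbit st su ls ss'.
Qed.

End Differential.

(** * Filling cycles in low degrees *)

Lemma cycle_boundary (R : realType) (g : nat) (D : perfect_complex_data R g) (k : int)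
    (z : perfect_chain D k) : k <= g%:Z - 2 -> boundary (k - 1) z = 0 ->
  exists w : perfect_chain D (k + 1), boundary k w = z.
Proof.
move=> kg dz.
pose c s := coeff s z; pose free_rep (s : reps D k) := coloop_free (val s).
(* [W s] is the contribution of [s] to the filling chain. The incidence number is 1 or -1, so
   multiplying by it amounts to dividing. *)
have /choice[W WP] : forall s : reps D k, exists Ws : perfect_chain D (k + 1),
    (free_rep s -> exists (i : reps D (k + 1)) s',
      [/\ same_orbit (val s) s', inflates s' (val i) &
          Ws = << (c s * delta D (val s) (val i)) *g i >>]) /\
    (~ free_rep s -> Ws = 0).
  move=> s; have [sf|snf] := EM (free_rep s); last by exists 0; split.
  have [i [s' [ss' si]]] := rep_inflation sf kg.
  exists << (c s * delta D (val s) (val i)) *g i >>; split=> // _.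
  by exists i, s'.
exists (\sum_(s <- dom z) W s); apply/eqP/freeg_eqP => u.
rewrite raddf_sum raddf_sum /=.
have [uf|/rep_coloop[F [F' [aF' F'f FF' Fu]]]] := EM (coloop_free (val u)).
  (* The only facet without coloop of the inflation of [s] lies in the orbit of [s], so at such a
     [u] no other term contributes. *)
  have term s : coeff u (boundary k (W s)) = (s == u)%:R * c s.
    have [sf|snf] := EM (free_rep s); last first.
      rewrite (WP s).2 // raddf0 coeff0.
      by have [su|_] := eqVneq s u; [case: snf; rewrite su|rewrite mul0r].
    have [i [s' [ss' si ->]]] := (WP s).1 sf; rewrite coeff_boundaryU.
    have s'f := coloop_free_same_orbit ss' sf.
    have as' := alternating_same_orbit ss' (rep_alternating s).
    have s'0 := lattice_cone0 (perfect_lattice_cone as'.1).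
    have [<-|su] := eqVneq s u.
      by rewrite (delta_inflation D si s'0 s'f ss') mul1r -mulrA eta_sq mulr1.
    have [->|/delta_neq0[r ir ur]] := eqVneq (delta D (val u) (val i)) 0.
      by rewrite mulr0 mul0r.
    have rs' : r = s' by apply: (coloop_free_facet si s'0 ir); exact: coloop_free_same_orbit ur uf.
    case/eqP: su; apply: val_inj; apply: (reps_uniq (set_valP _) (set_valP _)).
    by apply: same_orbit_trans ss' _; rewrite -rs'; exact: same_orbit_sym.
  under eq_bigr => s _ do rewrite term.
  have [uz|uz] := boolP (u \in dom z); last first.
    rewrite (coeff_outdom uz) big1_seq // => s /andP[_ sz].
    by have [su|_] := eqVneq s u; [rewrite -su sz in uz|rewrite mul0r].
  rewrite (big_rem u) //= eqxx mul1r big1_seq ?addr0 // => s.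
  by rewrite mem_rem_uniq ?uniq_dom // inE => /and3P[_ /negPf -> _]; rewrite mul0r.
have F'0 := lattice_cone0 (perfect_lattice_cone aF'.1).
pose e := delta D (val F) (val u).
have eE : e = Defs.eta D F' (val u) by exact: delta_inflation Fu F'0 F'f FF'.
have ee : e * e = 1 by rewrite eE eta_sq.
have sum0 : \sum_(s <- dom z) c s * delta D (val F) (val s) = 0.
  by rewrite -coeff_boundary dz coeff0.
(* The added terms sum to zero because [z] is a cycle. If [s] has no coloop, the two terms cancel by
   anticommutation. If it has one, its only facet without coloop is its base, and when this lies in
   the orbit of [F], uniqueness of inflation gives [s = u]. *)
have term s : coeff u (boundary k (W s)) * e + c s * delta D (val F) (val s) =
    (s == u)%:R * c s * e.
  have [sf|snf] := EM (free_rep s).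
    have -> : (s == u) = false.
      by apply/negP => /eqP su; apply: sf; rewrite su; exists F'.
    have [i [s' [ss' si ->]]] := (WP s).1 sf; rewrite coeff_boundaryU !mul0r.
    have s'f := coloop_free_same_orbit ss' sf.
    have as' := alternating_same_orbit ss' (rep_alternating s).
    have s'0 := lattice_cone0 (perfect_lattice_cone as'.1).
    have := delta_anticommute D aF' (rep_alternating u) as' (rep_alternating i) F'f s'f Fu si.
    rewrite -eE -(delta_inflation D si s'0 s'f ss') -(delta_same_orbit D _ FF').
    have [h uh s'E] := ss'.
    rewrite s'E (delta_act D (rep_alternating F) (rep_alternating s) uh) -/e => anti.
    have dd : delta D (val s) (val i) * delta D (val s) (val i) = 1.
      by rewrite (delta_inflation D si s'0 s'f ss') eta_sq.
    set d := delta D (val s) (val i) in anti dd *.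
    set x := delta D (val F) (val s) in anti *.
    set y := delta D (val u) (val i) in anti *.
    have -> : c s * d * y * e = c s * d * (e * y) by ring.
    have -> : e * y = - (x * d) by rewrite anti opprK.
    have -> : c s * d * - (x * d) = - (c s * x * (d * d)) by ring.
    by rewrite dd mulr1 addNr.
  rewrite (WP s).2 // raddf0 coeff0 mul0r add0r.
  have [->|su] := eqVneq s u; first by rewrite mul1r.
  rewrite !mul0r; have [->|/delta_neq0[r sr Fr]] := eqVneq (delta D (val F) (val s)) 0.
    by rewrite mulr0.
  have [F1 [F1' [aF1' F1'f _ F1s]]] := rep_coloop snf.
  have F1'0 := lattice_cone0 (perfect_lattice_cone aF1'.1).
  have rf : coloop_free r.
    exact: coloop_free_same_orbit (same_orbit_trans (same_orbit_sym FF') Fr) F'f.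
  have rF1 := coloop_free_facet F1s F1'0 sr rf.
  case/eqP: su; apply: (inflations_same_rep F1s Fu (perfect_lattice_cone aF1'.1)).
  by rewrite -rF1; exact: same_orbit_trans (same_orbit_sym Fr) FF'.
(* Since e^2 = 1, the two coefficients may be compared after multiplication by [e]. *)
apply: (can_inj (g := fun x => x * e) (f := fun x => x * e)) => [x|/=].
  by rewrite -mulrA ee mulr1.
transitivity (\sum_(s <- dom z)
    (coeff u (boundary k (W s)) * e + c s * delta D (val F) (val s))).
  by rewrite big_split /= sum0 addr0 mulr_suml.
under eq_bigr => s _ do rewrite term.
have [uz|uz] := boolP (u \in dom z); last first.
  rewrite (coeff_outdom uz) mul0r big1_seq // => s /andP[_ sz].
  by have [su|_] := eqVneq s u; [rewrite -su sz in uz|rewrite !mul0r].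
rewrite (big_rem u) //= eqxx mul1r big1_seq ?addr0 // => s.
by rewrite mem_rem_uniq ?uniq_dom // inE => /and3P[_ /negPf -> _]; rewrite !mul0r.
Qed.

Theorem corollary5p16 (R : realType) (g : nat) (hg : (1 <= g)%N)
    (D : perfect_complex_data R g) (k : int) (hk : k <= g%:Z - 2) :
  forall x : perfect_homology D k, x = 0.
Proof.
apply: quotW => z.
have pi0 : (\pi_(perfect_homology D k) 0)%qT = 0 by exact: raddf0.
rewrite -pi0; apply/eqP.
rewrite -Quotient.idealrBE subr0; apply/asboolP; apply: (cycle_boundary hk).
by apply/eqP; exact: valP z.
Qed.
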